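(* Let $f$ be a bounded juggling pattern of length $n$ with $k$ balls, and let $\lambda=\{\lambda_1<\dots<\lambda_k\}\in\binom{[n]}{k}$. Then there is an isomorphism of varieties $$\Pi_f|_\lambda\;\cong\;(\mathrm{AffFlag}_{k,n})_{f,\circ}^{t_\lambda}.$$ Moreover, the stratification of the big cell $(Gr_k\mathbb{C}^n)|_\lambda$ by its intersections with positroid varieties corresponds to the stratification of the affine opposite Schubert cell $(\mathrm{AffFlag}_{k,n})_\circ^{t_\lambda}$ by its intersections with the affine Schubert varieties $(\mathrm{AffFlag}_{k,n})_f$: there is an isomorphism $(Gr_k\mathbb{C}^n)|_\lambda\cong(\mathrm{AffFlag}_{k,n})_\circ^{t_\lambda}$ which, for every bounded juggling pattern $f$ of length $n$ with $k$ balls, carries $\Pi_f|_\lambda$ onto $(\mathrm{AffFlag}_{k,n})_{f,\circ}^{t_\lambda}$.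
   Context: **Juggling patterns.** A virtual juggling pattern of length $n$ is a bijection $f:\mathbb{Z}\to\mathbb{Z}$ with $f(i+n)=f(i)+n$ for all $i$. Its number of balls is $k=\frac1n\sum_{i=1}^n(f(i)-i)$. It is bounded if $i\le f(i)\le i+n$ for all $i$. **Positroid varieties.** $Gr_k\mathbb{C}^n=GL_k\backslash\{M\in M_{k\times n}(\mathbb{C}):\operatorname{rank}M=k\}$. For such an $M$, index the columns by $\mathbb{Z}$ with period $n$, and let $\operatorname{rank}([i,j])$ be the rank of the submatrix formed by columns $i,i+1,\dots,j$ (cyclically). For a bounded juggling pattern $f$ of length $n$ with $k$ balls, the (closed) positroid variety is $$\Pi_f=\{GL_k\cdot M:\ \operatorname{rank}([i,j])\le (j-i+1)-\#\{a\in\mathbb{Z}: a\ge i,\ f(a)\le j\}\ \text{ for all } i\le j\le i+n\}\subseteq Gr_k\mathbb{C}^n .$$ For $\lambda=\{\lambda_1<\dots<\lambda_k\}\subseteq[n]=\{1,\dots,n\}$, the big cell $(Gr_k\mathbb{C}^n)|_\lambda\cong\mathbb{C}^{k(n-k)}$ is the open subset of points represented by matrices $M$ whose $\lambda_i$-th column is the $i$-th column of the identity matrix $I_k$ (all other entries free). Set $\Pi_f|_\lambda=\Pi_f\cap(Gr_k\mathbb{C}^n)|_\lambda$. **Affine flags.** Work inside $\mathbb{C}[[t^{-1}]][t]=\mathbb{C}((t^{-1}))$. A lattice $L$ is a linear subspace such that $L\cap\mathbb{C}[[t^{-1}]]$ has finite codimension both in $L$ and in $\mathbb{C}[[t^{-1}]]$.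 Its index is $\dim(L/(L\cap\mathbb{C}[[t^{-1}]]))-\dim(\mathbb{C}[[t^{-1}]]/(L\cap\mathbb{C}[[t^{-1}]]))$. Put $$\mathrm{AffGr}_{k,n}=\{L\text{ a lattice}: t^{-n}L\subseteq L,\ \mathrm{index}(L)=k\},$$ $$\mathrm{AffFlag}_{k,n}=\{(L_i)_{i\in\mathbb{Z}}: L_i\in\mathrm{AffGr}_{k,n},\ L_i=L_{i+n},\ t^{-1}L_i\subseteq L_{i+1}\text{ for all } i\}.$$ **Coordinate flags.** A virtual juggling pattern $f$ of length $n$ with $k$ balls gives the torus-fixed flag $(L_i(f))_i$. Here $L_i(f)$ is the lattice consisting of all elements of $\mathbb{C}((t^{-1}))$ in which only the powers $t^j$ with $f^{-1}(i+j-1)<i$ occur. For $\lambda\in\binom{[n]}{k}$, the flag $t_\lambda$ is the one for the pattern $i\mapsto i+n$ if $(i\bmod n)\in\lambda$ and $i\mapsto i$ otherwise (residues taken in $[n]$). Thus $L_1(t_\lambda)=\mathbb{C}[[t^{-1}]]\oplus\bigoplus_{j\in\lambda}\mathbb{C}\,t^j$, and $L_i(t_\lambda)$ is obtained similarly from the rotation of $\lambda$ by $i-1$ places. **Schubert varieties.** For a virtual juggling pattern $f$ of length $n$ with $k$ balls, $$(\mathrm{AffFlag}_{k,n})_f=\{(L_i):\dim(L_i\cap t^m\mathbb{C}[t])\ge\dim(L_i(f)\cap t^m\mathbb{C}[t])\ \ \forall i,m\in\mathbb{Z}\}.$$ The affine opposite Schubert cell at $t_\lambda$ is $$(\mathrm{AffFlag}_{k,n})_\circ^{t_\lambda}=\Big\{(L_i):\dim\frac{L_i}{L_i\cap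 t^m\mathbb{C}[[t^{-1}]]}=\dim\frac{L_i(t_\lambda)}{L_i(t_\lambda)\cap t^m\mathbb{C}[[t^{-1}]]}\ \ \forall i,m\in\mathbb{Z}\Big\}.$$ The affine Kazhdan–Lusztig variety is $(\mathrm{AffFlag}_{k,n})_{f,\circ}^{t_\lambda}=(\mathrm{AffFlag}_{k,n})_f\cap(\mathrm{AffFlag}_{k,n})_\circ^{t_\lambda}$. Flags in $(\mathrm{AffFlag}_{k,n})_\circ^{t_\lambda}$ satisfy $\mathbb{C}[[t^{-1}]]\subseteq L_i\subseteq t^n\mathbb{C}[[t^{-1}]]$, so these are viewed as locally closed subvarieties of the product over $i=1,\dots,n$ of the Grassmannians $Gr_k(t^n\mathbb{C}[[t^{-1}]]/\mathbb{C}[[t^{-1}]])$. *)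

(* Defs.v *)
From HB Require Import structures.
From mathcomp Require Export all_boot all_order all_algebra finmap.
From mathcomp Require Export boolp classical_sets functions cardinality.
From mathcomp Require Export reals complex mpoly.
Export Order.TTheory GRing.Theory Num.Theory.

Set Implicit Arguments.
Unset Strict Implicit.
Unset Printing Implicit Defensive.

Local Open Scope ring_scope.
Local Open Scope classical_set_scope.

(* A (reduced, classical) variety over C is handled as a space with functions:
   the set of its points, its Zariski open sets, and for each open set U the
   regular functions on U.  Only the values on U of a member of [fs_reg U]
   are meaningful. *)

Record fun_space (C : fieldType) (T : Type) := FunSpace {
  fs_points : set T;
  fs_open : set (set T);
  fs_reg : set T -> set (T -> C) }.

Section FunSpaces.
Variable C : fieldType.

Definition is_morphism S T (X : fun_space C S) (Y : fun_space C T)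
    (phi : S -> T) : Prop :=
  [/\ forall x, fs_points X x -> fs_points Y (phi x),
      forall V, fs_open Y V -> fs_open X (fs_points X `&` phi @^-1` V)
    & forall V g, fs_open Y V -> fs_reg Y V g ->
        fs_reg X (fs_points X `&` phi @^-1` V) (g \o phi)].

Definition is_isomorphism S T (X : fun_space C S) (Y : fun_space C T)
    (phi : S -> T) : Prop :=
  is_morphism X Y phi /\
  exists psi : T -> S,
    [/\ is_morphism Y X psi,
        forall x, fs_points X x -> psi (phi x) = x
      & forall y, fs_points Y y -> phi (psi y) = y].

Definition isomorphic S T (X : fun_space C S) (Y : fun_space C T) : Prop :=
  exists phi : S -> T, is_isomorphism X Y phi.

(* Polynomials in the coordinates [x j], j : J; the variables of {mpoly _} are
   numbered by the enumeration of J. *)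
Definition poly_eval (J : finType) (p : {mpoly C[#|J|]}) (x : J -> C) : C :=
  p.@[fun v => x (enum_val v)].

(* The affine space of all points of T, for a coordinate system
   [coord : T -> (J -> C)] (a bijection in all uses below).  Regular functions
   are locally quotients of polynomials. *)
Definition affine_space (T : Type) (J : finType) (coord : T -> J -> C) :
    fun_space C T :=
  FunSpace setT
    [set U | exists E : set {mpoly C[#|J|]},
       U = [set x | exists2 p, E p & poly_eval p (coord x) != 0]]
    (fun U => [set g | forall x, U x -> exists p q : {mpoly C[#|J|]},
       poly_eval q (coord x) != 0 /\
       forall y, U y -> poly_eval q (coord y) != 0 ->
         g y = poly_eval p (coord y) / poly_eval q (coord y)]).

(* The structure induced on A by an injection iota of A into X: open sets are
   traces of open sets of X, and regular functions are locally restrictions of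
   regular functions of X.  For iota the inclusion of a locally closed A this
   is the usual structure of subvariety. *)
Definition induced_space S T (X : fun_space C T) (iota : S -> T) (A : set S) :
    fun_space C S :=
  FunSpace A
    [set U | exists2 V, fs_open X V & U = A `&` iota @^-1` V]
    (fun U => [set g | forall x, U x -> exists V h,
       [/\ fs_open X V, V (iota x), fs_reg X V h
         & forall y, U y -> V (iota y) -> g y = h (iota y)]]).

Definition subspace T (X : fun_space C T) (A : set T) : fun_space C T :=
  induced_space X id A.

Definition quotient_space S T (X : fun_space C S) (pi : S -> T) :
    fun_space C T :=
  FunSpace (pi @` fs_points X)
    [set U | U `<=` pi @` fs_points X /\
             fs_open X (fs_points X `&` pi @^-1` U)]
    (fun U => [set g : T -> C |
       fs_reg X (fs_points X `&` pi @^-1` U) (g \o pi)]).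

(* The point GL_k . M of the Grassmannian. *)
Definition GL_orbit k n (M : 'M[C]_(k, n)) : set 'M[C]_(k, n) :=
  [set N | exists2 g : 'M[C]_k, g \in unitmx & N = g *m M].

Definition Gr k n : fun_space C (set 'M[C]_(k, n)) :=
  quotient_space
    (subspace
      (affine_space (fun (M : 'M[C]_(k, n)) (e : 'I_k * 'I_n) => M e.1 e.2))
      [set M | \rank M = k])
    (@GL_orbit k n).

(* The product of m copies of [Gr k n], as the quotient by (GL_k)^m of the
   m-tuples of matrices of rank k.  The Zariski topology of a product is not
   the product topology, hence the passage through tuples. *)
Definition Gr_power m k n : fun_space C ('I_m -> set 'M[C]_(k, n)) :=
  quotient_space
    (subspace
      (affine_space (fun (M : 'I_m -> 'M[C]_(k, n))
                         (e : 'I_m * 'I_k * 'I_n) => M e.1.1 e.1.2 e.2))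
      [set M | forall i, \rank (M i) = k])
    (fun M i => GL_orbit (M i)).

End FunSpaces.

Definition virtual_juggling (n : nat) (f : int -> int) : Prop :=
  bijective f /\ forall i : int, f (i + n%:Z) = f i + n%:Z.

Definition balls (n : nat) (f : int -> int) : rat :=
  n%:Q^-1 * (\sum_(1 <= i < n.+1) (f i%:Z - i%:Z))%:~R.

Definition bounded_juggling (n k : nat) (f : int -> int) : Prop :=
  [/\ virtual_juggling n f,
      balls n f = k%:Q
    & forall i : int, i <= f i <= i + n%:Z].

(* Column (resp. element) number a of [n] = {1, ..., n} is the ordinal a - 1
   of 'I_n. *)

Section Positroid.
Variable C : fieldType.

(* The column of M with index a in Z, periodically in a; the default value 0
   only occurs for n = 0. *)
Definition periodic_col k n (M : 'M[C]_(k, n)) (a : int) : 'cV[C]_k :=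
  if [pick c : 'I_n | (a == c.+1%:Z %[mod n%:Z])%Z] is Some c
  then col c M else 0.

(* The rank of the columns i, i + 1, ..., j, for i <= j. *)
Definition interval_rank k n (M : 'M[C]_(k, n)) (i j : int) : nat :=
  \rank (\matrix_(r < k, s < absz (j - i + 1)) periodic_col M (i + s%:Z) r 0).

Definition positroid k n (f : int -> int) : set (set 'M[C]_(k, n)) :=
  [set P | exists M : 'M[C]_(k, n),
    [/\ P = GL_orbit M, \rank M = k
      & forall i j : int, i <= j <= i + n%:Z ->
          (interval_rank M i j)%:Z <=
            (j - i + 1) - #|` fset_set [set a : int | i <= a /\ f a <= j]|%:Z]].

(* lam enumerates increasingly the elements of a k-subset of [n]. *)
Definition big_cell k n (lam : 'I_k -> 'I_n) : set (set 'M[C]_(k, n)) :=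
  [set P | exists M : 'M[C]_(k, n), P = GL_orbit M /\ colsub lam M = 1%:M].

Definition big_cell_var k n (lam : 'I_k -> 'I_n) :
    fun_space C (set 'M[C]_(k, n)) :=
  subspace (Gr C k n) (big_cell lam).

Definition positroid_cell_var k n (f : int -> int) (lam : 'I_k -> 'I_n) :
    fun_space C (set 'M[C]_(k, n)) :=
  subspace (Gr C k n) (positroid f `&` big_cell lam).

End Positroid.

Section Dimension.
Variables (C : fieldType) (V : lmodType C).

Definition linear_subspace (L : set V) : Prop :=
  L 0 /\ forall (a : C) (x y : V), L x -> L y -> L (a *: x + y).

(* dim (L / K) = d, for linear subspaces K of L: some d vectors of L induce a
   basis of L / K. *)
Definition quot_dim_eq (L K : set V) (d : nat) : Prop :=
  exists v : 'I_d -> V, (forall i, L (v i)) /\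
    forall x, L x -> exists! c : 'rV[C]_d, K (x - \sum_i c 0 i *: v i).

Definition fin_codim (L K : set V) : Prop := exists d, quot_dim_eq L K d.

(* 0 when the dimension is infinite. *)
Definition quot_dim (L K : set V) : nat := xget 0%N [set d | quot_dim_eq L K d].

Definition subspace_dim (L : set V) : nat := quot_dim L [set 0].

End Dimension.

(* x : formal C stands for the formal sum of the x j t^j, j in Z; C^o is C as a
   vector space over itself, and operations on functions are pointwise. *)
Notation formal C := (int -> GRing.regular C).

Section AffineFlags.
Variable C : fieldType.

Definition laurent : set (formal C) :=
  [set x | exists N : int, forall j, N < j -> x j = 0].

(* t^m C[[t^-1]] *)
Definition tpow_series (m : int) : set (formal C) :=
  [set x | forall j, m < j -> x j = 0].

(* t^m C[t]; a Laurent series in t^-1 has finitely many nonzero terms of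
   exponent at least m. *)
Definition tpow_poly (m : int) : set (formal C) :=
  [set x | laurent x /\ forall j, j < m -> x j = 0].

Definition series : set (formal C) := tpow_series 0.

(* multiplication by t^m *)
Definition tshift (m : int) (x : formal C) : formal C := fun j => x (j - m).

Definition lattice (L : set (formal C)) : Prop :=
  [/\ linear_subspace L, L `<=` laurent,
      fin_codim L (L `&` series) & fin_codim series (L `&` series)].

Definition lattice_index (L : set (formal C)) : int :=
  (quot_dim L (L `&` series))%:Z - (quot_dim series (L `&` series))%:Z.

Definition AffGr (k n : nat) : set (set (formal C)) :=
  [set L | [/\ lattice L, tshift (- n%:Z) @` L `<=` L
             & lattice_index L = k%:Z]].

Definition AffFlag (k n : nat) : set (int -> set (formal C)) :=
  [set L | [/\ forall i, AffGr k n (L i),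
               forall i, L i = L (i + n%:Z)
             & forall i, tshift (- 1) @` L i `<=` L (i + 1)]].

(* f is bijective in all uses, so that the condition on j says
   f^-1 (i + j - 1) < i. *)
Definition coord_flag (f : int -> int) (i : int) : set (formal C) :=
  [set x | laurent x /\
           forall j, x j != 0 -> exists2 a : int, f a = i + j - 1 & a < i].

Definition t_pattern k n (lam : 'I_k -> 'I_n) (i : int) : int :=
  if [exists r, (i == (lam r).+1%:Z %[mod n%:Z])%Z] then i + n%:Z else i.

Definition affine_schubert (k n : nat) (f : int -> int) :
    set (int -> set (formal C)) :=
  [set L | AffFlag k n L /\ forall i m : int,
     (subspace_dim (coord_flag f i `&` tpow_poly m) <=
      subspace_dim (L i `&` tpow_poly m))%N].

Definition opposite_cell k n (lam : 'I_k -> 'I_n) : set (int -> set (formal C)) :=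
  [set L | AffFlag k n L /\ forall i m : int,
     let L0 := coord_flag (t_pattern lam) in
     quot_dim (L i) (L i `&` tpow_series m) =
     quot_dim (L0 i) (L0 i `&` tpow_series m)].

(* For C[[t^-1]] <= L <= t^n C[[t^-1]], the point L / C[[t^-1]] of
   Gr_k (t^n C[[t^-1]] / C[[t^-1]]), in the basis t^1, ..., t^n (column c being
   the coefficient of t^(c+1)): the set of the matrices whose rows are a basis
   of L / C[[t^-1]]. *)
Definition lattice_point k n (L : set (formal C)) : set 'M[C]_(k, n) :=
  [set M | \rank M = k /\
     L = [set x | tpow_series n%:Z x /\
                  (\row_(c < n) (x c.+1%:Z : C) <= M)%MS]].

Definition flag_point k n (L : int -> set (formal C)) :
    'I_n -> set 'M[C]_(k, n) :=
  fun i => @lattice_point k n (L i.+1%:Z).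

Definition opposite_cell_var k n (lam : 'I_k -> 'I_n) :
    fun_space C (int -> set (formal C)) :=
  induced_space (Gr_power C n k n) (@flag_point k n) (opposite_cell lam).

Definition affine_KL_var k n (f : int -> int) (lam : 'I_k -> 'I_n) :
    fun_space C (int -> set (formal C)) :=
  induced_space (Gr_power C n k n) (@flag_point k n)
    (affine_schubert k n f `&` opposite_cell lam).

End AffineFlags.

(* Main.v *)
Require Import Defs.
From mathcomp Require Import zify.

Set Implicit Arguments.
Unset Strict Implicit.
Unset Printing Implicit Defensive.

(** A point of the big cell has a unique representative M whose columns
    lam are the identity.  Read the columns of M periodically, and for an
    integer i keep, in the window of columns i, ..., i + n - 1, the entries of
    row r up to the occurrence of the column lam r ([window]).  The rows of
    this matrix, column c being the coefficient of t^(c + 1), span together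
    with C[[t^-1]] a lattice L_i, and (L_i) is the flag attached to M
    ([cell_to_flag]).  Shifting the window by one replaces the row whose pivot
    leaves on the left by the same row of M with its pivot entering on the
    right, and merely translates the other rows; this is t^-1 L_i <= L_(i+1).

    All flags of the opposite cell arise once.  The dimensions that define the
    cell prescribe the leading exponents of L_i, so L_i / C[[t^-1]] has a
    unique basis in echelon form with pivots at the positions of the columns
    lam ([reduced_mxP]).  The inclusion t^-1 L_i <= L_(i+1) forces each row of
    the echelon form to be translated, until its pivot leaves
    ([reduced_mx_shift]); hence all echelon forms are the windows of the single
    matrix obtained by taking each row at the index where its pivot is last
    ([reduced_mx_window]).

    The truncation of the rows does not affect ranks of initial segments of a
    window: a truncated row has its pivot, a unit column, inside the segment,
    and that column clears the row in either matrix ([interval_rank_window]).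
    For m > 0, dim (L_i /\ t^m C[t]) is k minus such a rank, so the Schubert conditions
    for f are the rank conditions of the positroid variety; the two right-hand
    sides agree because exactly k balls are in the air at any time and a ball
    landing in an interval was thrown either before it or inside it
    ([card_balls_in_air], [card_balls_below], [schubert_positroid]).

    Both maps are regular by Cramer's rule: the representative of a point with
    prescribed unit columns e is colsub e N ^ -1 N for any representative N
    ([reg_normal_rep]).  The remaining ingredient is the formalism of spaces
    with functions: affine spaces, subspaces and quotients obey the axioms of
    [space_axioms], and under these a map into an affine space is a morphism
    as soon as its coordinates are regular ([morphism_affine]). *)

Local Open Scope ring_scope.
Local Open Scope classical_set_scope.

(** * Spaces with functions *)

Section SpacesWithFunctions.
Variable C : fieldType.

(** The regular functions form a sheaf of rings on a topological space, in
    which a function is invertible where it does not vanish, and its nonzero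
    locus is open.  Locality is stated so that it gives at once gluing,
    restriction to smaller open sets and independence of the values outside
    of U: the local witnesses h need only agree with g on the common domain. *)
Record space_axioms T (X : fun_space C T) : Prop := SpaceAxioms {
  open_sub : forall U, fs_open X U -> U `<=` fs_points X;
  open_points : fs_open X (fs_points X);
  open_bigcup : forall F : set (set T), F `<=` fs_open X ->
    fs_open X [set x | exists2 U, F U & U x];
  open_setI : forall U V, fs_open X U -> fs_open X V -> fs_open X (U `&` V);
  reg_local : forall U g, fs_open X U ->
    (forall x, U x -> exists V h, [/\ fs_open X V, V x, fs_reg X V h
       & forall y, U y -> V y -> g y = h y]) -> fs_reg X U g;
  reg_cst : forall U a, fs_open X U -> fs_reg X U (fun=> a);
  reg_add : forall U g h, fs_open X U -> fs_reg X U g -> fs_reg X U h ->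
    fs_reg X U (fun x => g x + h x);
  reg_mul : forall U g h, fs_open X U -> fs_reg X U g -> fs_reg X U h ->
    fs_reg X U (fun x => g x * h x);
  reg_inv : forall U g, fs_open X U -> fs_reg X U g ->
    (forall x, U x -> g x != 0) -> fs_reg X U (fun x => (g x)^-1);
  open_neq0 : forall U g, fs_open X U -> fs_reg X U g ->
    fs_open X (U `&` [set x | g x != 0]) }.

Section Theory.
Variables (T : Type) (X : fun_space C T).
Hypothesis HX : space_axioms X.

Lemma reg_restrict U V g : fs_open X U -> fs_open X V -> U `<=` V ->
  fs_reg X V g -> fs_reg X U g.
Proof.
move=> oU oV UV rg; apply: (reg_local HX oU) => x Ux.
by exists V, g; split => //; apply: UV.
Qed.

Lemma reg_ext U g h : fs_open X U -> (forall x, U x -> g x = h x) ->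
  fs_reg X U h -> fs_reg X U g.
Proof.
move=> oU gh rh; apply: (reg_local HX oU) => x Ux.
by exists U, h; split => // y Uy _; apply: gh.
Qed.

Lemma reg_sum I (r : seq I) (P : pred I) (F : I -> T -> C) U : fs_open X U ->
  (forall i, P i -> fs_reg X U (F i)) ->
  fs_reg X U (fun x => \sum_(i <- r | P i) F i x).
Proof.
move=> oU rF; elim: r => [|i r IH].
  apply: (reg_ext oU (h := fun=> 0)); last exact: (reg_cst HX).
  by move=> x _; rewrite big_nil.
case Pi: (P i); last first.
  by apply: (reg_ext oU _ IH) => x _; rewrite big_cons Pi.
apply: (reg_ext oU (h := fun x => F i x + \sum_(j <- r | P j) F j x)).
  by move=> x _; rewrite big_cons Pi.
by apply: (reg_add HX) => //; apply: rF.
Qed.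

Lemma reg_prod I (r : seq I) (P : pred I) (F : I -> T -> C) U : fs_open X U ->
  (forall i, P i -> fs_reg X U (F i)) ->
  fs_reg X U (fun x => \prod_(i <- r | P i) F i x).
Proof.
move=> oU rF; elim: r => [|i r IH].
  apply: (reg_ext oU (h := fun=> 1)); last exact: (reg_cst HX).
  by move=> x _; rewrite big_nil.
case Pi: (P i); last first.
  by apply: (reg_ext oU _ IH) => x _; rewrite big_cons Pi.
apply: (reg_ext oU (h := fun x => F i x * \prod_(j <- r | P j) F j x)).
  by move=> x _; rewrite big_cons Pi.
by apply: (reg_mul HX) => //; apply: rF.
Qed.

Lemma reg_exp U g m : fs_open X U -> fs_reg X U g ->
  fs_reg X U (fun x => g x ^+ m).
Proof.
move=> oU rg; elim: m => [|m IH].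
  by apply: (reg_ext oU (h := fun=> 1)) => //; apply: (reg_cst HX).
apply: (reg_ext oU (h := fun x => g x * g x ^+ m)).
  by move=> x _; rewrite exprS.
exact: (reg_mul HX).
Qed.

Lemma reg_poly_eval (J : finType) (p : {mpoly C[#|J|]}) (phi : T -> J -> C) U :
  fs_open X U -> (forall j, fs_reg X U (fun x => phi x j)) ->
  fs_reg X U (fun x => poly_eval p (phi x)).
Proof.
move=> oU rphi.
apply: (reg_ext oU (h := fun x => \sum_(m <- msupp p)
   p@_m * \prod_i phi x (enum_val i) ^+ m i)).
  by move=> x _; rewrite /poly_eval mevalE.
apply: reg_sum => // m _; apply: (reg_mul HX) => //; first exact: (reg_cst HX).
by apply: reg_prod => // i _; apply: reg_exp.
Qed.

Lemma reg_det m (A : T -> 'M[C]_m) U : fs_open X U ->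
  (forall i j, fs_reg X U (fun x => A x i j)) ->
  fs_reg X U (fun x => \det (A x)).
Proof.
move=> oU rA; apply: reg_sum => // s _; apply: (reg_mul HX) => //.
  exact: (reg_cst HX).
by apply: reg_prod.
Qed.

(** Cramer's rule: the entries of the inverse are cofactors divided by the
    determinant. *)
Lemma reg_invmx m (A : T -> 'M[C]_m) U : fs_open X U ->
  (forall i j, fs_reg X U (fun x => A x i j)) ->
  (forall x, U x -> A x \in unitmx) ->
  forall i j, fs_reg X U (fun x => invmx (A x) i j).
Proof.
move=> oU rA uA i j.
apply: (reg_ext oU
  (h := fun x => (\det (A x))^-1 * ((-1) ^+ (j + i) *
          \det (row' j (col' i (A x)))))).
  by move=> x Ux; rewrite /invmx uA // !mxE.
apply: (reg_mul HX) => //.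
  apply: (reg_inv HX) => //; first exact: reg_det.
  by move=> x Ux; rewrite -unitfE -unitmxE uA.
apply: (reg_mul HX) => //; first exact: (reg_cst HX).
apply: reg_det => // a b; apply: (reg_ext oU (h := fun x => A x (lift j a) (lift i b))) => //.
by move=> x _; rewrite !mxE.
Qed.

Lemma open_det_neq0 m (A : T -> 'M[C]_m) :
  (forall i j, fs_reg X (fs_points X) (fun x => A x i j)) ->
  fs_open X (fs_points X `&` [set x | A x \in unitmx]).
Proof.
move=> rA.
have oX := open_points HX.
have := open_neq0 HX oX (reg_det oX rA); congr (fs_open X (_ `&` _)).
by apply/seteqP; split => x /=; rewrite unitmxE unitfE.
Qed.

End Theory.

Section PolyEval.
Variable J : finType.
Implicit Types (p q : {mpoly C[#|J|]}) (x : J -> C).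

Lemma poly_evalD p q x : poly_eval (p + q) x = poly_eval p x + poly_eval q x.
Proof. exact: mevalD. Qed.

Lemma poly_evalM p q x : poly_eval (p * q) x = poly_eval p x * poly_eval q x.
Proof. exact: mevalM. Qed.

Lemma poly_evalC (a : C) x : poly_eval a%:MP_[#|J|] x = a.
Proof. exact: mevalC. Qed.

Lemma poly_eval1 x : poly_eval (1 : {mpoly C[#|J|]}) x = 1.
Proof. exact: meval1. Qed.

End PolyEval.

Section AffineSpace.
Variables (T : Type) (J : finType) (coord : T -> J -> C).
Let X := affine_space coord.

(** Locally a regular function is a fraction p / q; the only care needed is
    that a bound valid on a principal open set D(e) becomes valid on the
    domain of a fraction after multiplying numerator and denominator by e. *)
Lemma affine_space_axioms : space_axioms X.
Proof.
split.
- by move=> *.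
- exists [set 1]; apply/seteqP; split => // x _ /=.
  by exists 1 => //; rewrite poly_eval1 oner_neq0.
- move=> F FX; exists [set p | exists2 U, F U & forall x, poly_eval p (coord x) != 0 -> U x].
  apply/seteqP; split => x /=.
    move=> [U FU Ux]; have [E EU] := FX _ FU.
    move: Ux; rewrite EU => -[p Ep px]; exists p => //; exists U => // y py.
    by rewrite EU; exists p.
  by move=> [p [U FU pU] px]; exists U => //; apply: pU.
- move=> _ _ [D ->] [E ->].
  exists [set r | exists p q, [/\ D p, E q & r = p * q]].
  apply/seteqP; split => x /=.
    move=> [[p Dp px] [q Eq qx]]; exists (p * q); first by exists p, q.
    by rewrite poly_evalM mulf_neq0.
  move=> [_ [p [q [Dp Eq ->]]]]; rewrite poly_evalM mulf_eq0 negb_or.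
  by case/andP=> px qx; split; [exists p|exists q].
- move=> U g _ loc x Ux; have [_ [h [[E ->] [e Ee ex] rh gh]]] := loc x Ux.
  have [|p [q [qx hpq]]] := rh x; first by exists e.
  exists (p * e), (q * e); split.
    by rewrite poly_evalM mulf_neq0.
  move=> y Uy; rewrite !poly_evalM mulf_eq0 negb_or => /andP[qy ey].
  have Vy : exists2 p, E p & poly_eval p (coord y) != 0 by exists e.
  by rewrite gh // hpq // -mulf_div divff // mulr1.
- move=> U a _ x Ux; exists a%:MP, 1; split.
    by rewrite poly_eval1 oner_neq0.
  by move=> y _ _; rewrite poly_eval1 poly_evalC divr1.
- move=> U g h _ rg rh x Ux.
  have [p [q [qx gpq]]] := rg x Ux; have [p' [q' [qx' hpq]]] := rh x Ux.
  exists (p * q' + p' * q), (q * q'); split.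
    by rewrite poly_evalM mulf_neq0.
  move=> y Uy; rewrite poly_evalD !poly_evalM.
  rewrite mulf_eq0 negb_or => /andP[qy qy'].
  by rewrite gpq // hpq // addf_div.
- move=> U g h _ rg rh x Ux.
  have [p [q [qx gpq]]] := rg x Ux; have [p' [q' [qx' hpq]]] := rh x Ux.
  exists (p * p'), (q * q'); split.
    by rewrite poly_evalM mulf_neq0.
  move=> y Uy; rewrite !poly_evalM.
  rewrite mulf_eq0 negb_or => /andP[qy qy'].
  by rewrite gpq // hpq // mulf_div.
- move=> U g _ rg g0 x Ux.
  have [p [q [qx gpq]]] := rg x Ux.
  exists (q * q), (p * q); split.
    rewrite poly_evalM mulf_neq0 //.
    by move: (g0 x Ux); rewrite gpq // mulf_eq0 negb_or => /andP[].
  move=> y Uy; rewrite !poly_evalM.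
  rewrite mulf_eq0 negb_or => /andP[py qy].
  by rewrite gpq // invf_div -mulf_div divff // mulr1.
- move=> _ g [E ->] rg.
  exists [set r | exists e p q, [/\ E e, r = e * p * q &
    forall y, poly_eval (e * p * q) (coord y) != 0 ->
      g y = poly_eval p (coord y) / poly_eval q (coord y)]].
  apply/seteqP; split => x /=.
    move=> [[e Ee ex] gx]; have [|p [q [qx gpq]]] := rg x; first by exists e.
    have Ux : exists2 e, E e & poly_eval e (coord x) != 0 by exists e.
    exists (e * p * q); last first.
      rewrite !poly_evalM !mulf_neq0 //.
      by move: gx; rewrite gpq // mulf_eq0 negb_or => /andP[].
    exists e, p, q; split => // y; rewrite !poly_evalM !mulf_eq0 !negb_or.
    by case/andP=> /andP[ey py] qy; apply: gpq => //; exists e.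
  move=> [_ [e [p [q [Ee -> gpq]]]] rx]; split.
    exists e => //.
    by move: rx; rewrite !poly_evalM !mulf_eq0 !negb_or => /andP[/andP[]].
  rewrite (gpq x rx).
  move: rx; rewrite !poly_evalM !mulf_eq0 !negb_or => /andP[/andP[_ px] qx].
  by rewrite px invr_eq0.
Qed.

Lemma coord_reg j : fs_reg X setT (fun x => coord x j).
Proof.
move=> x _; exists 'X_(enum_rank j), 1; split.
  by rewrite poly_eval1 oner_neq0.
by move=> y _ _; rewrite poly_eval1 divr1 /poly_eval mevalXU enum_rankK.
Qed.

(** The universal property of affine space: polynomials and fractions in
    regular functions are regular, and preimages of principal open sets are
    nonzero loci of regular functions. *)
Lemma morphism_affine S (Z : fun_space C S) (phi : S -> T) : space_axioms Z ->
  (forall j, fs_reg Z (fs_points Z) (fun z => coord (phi z) j)) ->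
  is_morphism Z X phi.
Proof.
move=> HZ rphi; have oZ := open_points HZ.
have rpe p : fs_reg Z (fs_points Z) (fun z => poly_eval p (coord (phi z))).
  exact: (reg_poly_eval HZ p (phi := fun z => coord (phi z))).
have op p : fs_open Z (fs_points Z `&` [set z | poly_eval p (coord (phi z)) != 0]).
  exact: (open_neq0 HZ).
have oV V : fs_open X V -> fs_open Z (fs_points Z `&` phi @^-1` V).
  move=> [E ->].
  rewrite (_ : _ `&` _ = [set z | exists2 U, [set U | exists2 p, E p &
    U = fs_points Z `&` [set z | poly_eval p (coord (phi z)) != 0]] U & U z]).
    by apply: (open_bigcup HZ) => _ [p Ep ->].
  apply/seteqP; split => z /=.
    move=> [Zz [p Ep pz]].
    by exists (fs_points Z `&` [set z | poly_eval p (coord (phi z)) != 0]) => //; exists p.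
  by move=> [_ [p Ep ->] [Zz pz]]; split => //; exists p.
split => // V g Vo rg; apply: (reg_local HZ); first exact: oV.
move=> z [Zz Vz]; have [p [q [qz gpq]]] := rg _ Vz.
exists (fs_points Z `&` [set z | poly_eval q (coord (phi z)) != 0]),
  (fun z => poly_eval p (coord (phi z)) * (poly_eval q (coord (phi z)))^-1); split => //.
  have sub : fs_points Z `&` [set z | poly_eval q (coord (phi z)) != 0] `<=` fs_points Z.
    by move=> ? [].
  apply: (reg_mul HZ) => //; first exact: (reg_restrict HZ _ oZ).
  apply: (reg_inv HZ) => //; first exact: (reg_restrict HZ _ oZ).
  by move=> y [].
by move=> y [_ Vy] [_ qy]; apply: gpq.
Qed.

End AffineSpace.

Section InducedSpace.
Variables (S T : Type) (X : fun_space C T) (iota : S -> T) (A : set S).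
Hypothesis HX : space_axioms X.
Let Y := induced_space X iota A.

(** Closure under unions needs a choice of extensions of the given open
    sets; taking the union of all open sets of X with an admissible trace
    avoids choosing. *)
Lemma induced_space_axioms : (forall x, A x -> fs_points X (iota x)) ->
  space_axioms Y.
Proof.
move=> AX; split.
- by move=> _ [V _ ->] x [].
- exists (fs_points X); first exact: (open_points HX).
  by apply/seteqP; split => [x Ax|x []] //; split => //; apply: AX.
- move=> F FY.
  exists [set x | exists2 V, [set V | fs_open X V /\ F (A `&` iota @^-1` V)] V & V x].
    by apply: (open_bigcup HX) => V /= [].
  apply/seteqP; split => x /=.
    move=> [U FU Ux]; have [V oV UV] := FY _ FU; move: Ux; rewrite UV => -[Ax Vx].
    by split => //; exists V => //; split => //; rewrite -UV.
  by move=> [Ax [V [oV FV] Vx]]; exists (A `&` iota @^-1` V).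
- move=> _ _ [V oV ->] [W oW ->]; exists (V `&` W); first exact: (open_setI HX).
  by apply/seteqP; split => x /= [] => [[? ?] [? ?]|? []].
- move=> U g oU loc x Ux.
  have [_ [h [[V oV ->] [Ax Vx] rh gh]]] := loc x Ux.
  have [|W [h' [oW Wx rh' hh]]] := rh x => //.
  exists (V `&` W), h'; split => //; first exact: (open_setI HX).
    exact: (reg_restrict HX (open_setI HX oV oW) oW (@subIsetr _ V W) rh').
  move=> y Uy [Vy Wy].
  have Ay : A y by move: oU Uy => [? _ ->] [].
  by rewrite gh // hh.
- move=> _ a [V oV ->] x [Ax Vx]; exists V, (fun=> a); split => //.
  exact: (reg_cst HX).
- move=> U g h _ rg rh x Ux.
  have [V [g' [oV Vx rg' gg]]] := rg x Ux.
  have [W [h' [oW Wx rh' hh]]] := rh x Ux.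
  have oVW := open_setI HX oV oW.
  exists (V `&` W), (fun x => g' x + h' x); split => //.
    by apply: (reg_add HX) => //;
       [apply: (reg_restrict HX _ oV)|apply: (reg_restrict HX _ oW)] => // y [].
  by move=> y Uy [Vy Wy]; rewrite gg // hh.
- move=> U g h _ rg rh x Ux.
  have [V [g' [oV Vx rg' gg]]] := rg x Ux.
  have [W [h' [oW Wx rh' hh]]] := rh x Ux.
  have oVW := open_setI HX oV oW.
  exists (V `&` W), (fun x => g' x * h' x); split => //.
    by apply: (reg_mul HX) => //;
       [apply: (reg_restrict HX _ oV)|apply: (reg_restrict HX _ oW)] => // y [].
  by move=> y Uy [Vy Wy]; rewrite gg // hh.
- move=> U g _ rg g0 x Ux.
  have [V [g' [oV Vx rg' gg]]] := rg x Ux.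
  have oV' := open_neq0 HX oV rg'.
  exists (V `&` [set x | g' x != 0]), (fun x => (g' x)^-1); split => //.
  + by split => //=; rewrite -gg // g0.
  + apply: (reg_inv HX) => //; last by move=> y [].
    by apply: (reg_restrict HX _ oV) => // y [].
  + by move=> y Uy [Vy _]; rewrite gg.
- move=> _ g [V oV ->] rg.
  pose N := (A `&` iota @^-1` V) `&` [set x | g x != 0].
  exists [set x | exists2 W,
    [set W | fs_open X W /\ A `&` iota @^-1` W `<=` N] W & W x].
    by apply: (open_bigcup HX) => W /= [].
  apply/seteqP; split => x /=.
    move=> [[Ax Vx] gx]; split => //.
    have [|W [h [oW Wx rh gh]]] := rg x => //.
    have oVW := open_setI HX oV oW.
    have rh' : fs_reg X (V `&` W) h.
      by apply: (reg_restrict HX _ oW) => // y [].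
    exists ((V `&` W) `&` [set x | h x != 0]); last by split => //=; rewrite -gh.
    split; first exact: (open_neq0 HX).
    by move=> y [Ay [[Vy Wy] hy]]; split => //=; rewrite gh.
  by move=> [Ax [W [oW WN] Wx]]; apply: WN.
Qed.

Lemma morphism_to_induced R (Z : fun_space C R) (phi : R -> S) :
  space_axioms Z -> (forall z, fs_points Z z -> A (phi z)) ->
  is_morphism Z X (iota \o phi) -> is_morphism Z Y phi.
Proof.
move=> HZ ZA [_ oX rX].
have oY V : fs_points Z `&` phi @^-1` (A `&` iota @^-1` V) =
            fs_points Z `&` (iota \o phi) @^-1` V.
  apply/seteqP; split => z [Zz] /=; first by move=> [].
  by move=> Vz; split => //; split => //; apply: ZA.
split => //.
  by move=> _ [V oV ->]; rewrite oY; apply: oX.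
move=> _ g [V oV ->] rg; rewrite oY; apply: (reg_local HZ); first exact: oX.
move=> z [Zz Vz]; have [|W [h [oW Wz rh gh]]] := rg (phi z).
  by split => //; apply: ZA.
exists (fs_points Z `&` (iota \o phi) @^-1` W), (h \o (iota \o phi)).
split => //; [exact: oX|exact: rX|].
by move=> y [Zy Vy] [_ Wy] /=; apply: gh => //; split => //; apply: ZA.
Qed.

Lemma induced_reg V g : fs_open X V -> (forall x, A x -> V (iota x)) ->
  fs_reg X V g -> fs_reg Y A (g \o iota).
Proof. by move=> oV AV rg x Ax; exists V, g; split => //; apply: AV. Qed.

Lemma induced_morphism : (forall x, A x -> fs_points X (iota x)) ->
  is_morphism Y X iota.
Proof.
move=> AX; split => //; first by move=> V oV; exists V.
by move=> V g oV rg x [Ax Vx]; exists V, g.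
Qed.

End InducedSpace.

Section QuotientSpace.
Variables (S T : Type) (X : fun_space C S) (pi : S -> T).
Hypothesis HX : space_axioms X.
Let Y := quotient_space X pi.
Let pr U := fs_points X `&` pi @^-1` U.

Lemma quotient_space_axioms : space_axioms Y.
Proof.
split.
- by move=> U [].
- split => //=; rewrite (_ : _ `&` _ = fs_points X); first exact: (open_points HX).
  by apply/seteqP; split => x // => [[]|Xx] //; split => //; exists x.
- move=> F FY; split.
    by move=> y [U FU Uy]; have [UX _] := FY _ FU; apply: UX.
  rewrite (_ : _ `&` _ = [set x | exists2 U, [set U | exists2 V, F V & U = pr V] U & U x]).
    by apply: (open_bigcup HX) => _ [V FV ->]; have [] := FY _ FV.
  apply/seteqP; split => x /=.
    by move=> [Xx [U FU Ux]]; exists (pr U) => //; exists U.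
  by move=> [_ [V FV ->] [Xx Vx]]; split => //; exists V.
- move=> U V [UX oU] [VX oV]; split; first by move=> y [/UX].
  rewrite (_ : _ `&` _ = pr U `&` pr V); first exact: (open_setI HX).
  by apply/seteqP; split => x [] => [? []|[? ?] []].
- move=> U g [UX oU] loc; apply: (reg_local HX oU) => x [Xx Ux].
  have [V [h [[VX oV] Vx rh gh]]] := loc _ Ux.
  by exists (pr V), (h \o pi); split => // y [_ Uy] [_ Vy]; apply: gh.
- by move=> U a [UX oU]; apply: (reg_cst HX).
- by move=> U g h [UX oU] rg rh; apply: (reg_add HX oU rg rh).
- by move=> U g h [UX oU] rg rh; apply: (reg_mul HX oU rg rh).
- move=> U g [UX oU] rg g0; apply: (reg_inv HX oU rg).
  by move=> x [_ Ux]; apply: g0.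
- move=> U g [UX oU] rg; split; first by move=> y [/UX].
  rewrite (_ : _ `&` _ = pr U `&` [set x | g (pi x) != 0]).
    exact: (open_neq0 HX oU rg).
  by apply/seteqP; split => x [] => [? []|[]].
Qed.

Lemma quotient_morphism : is_morphism X Y pi.
Proof.
split; first by move=> x Xx; exists x.
  by move=> V [].
by move=> V g [].
Qed.

End QuotientSpace.

Lemma morphism_comp S T R (X : fun_space C S) (Y : fun_space C T)
    (Z : fun_space C R) phi psi :
  is_morphism X Y phi -> is_morphism Y Z psi -> is_morphism X Z (psi \o phi).
Proof.
move=> [pXY oXY rXY] [pYZ oYZ rYZ].
have E V : fs_points X `&` (psi \o phi) @^-1` V =
           fs_points X `&` phi @^-1` (fs_points Y `&` psi @^-1` V).
  by apply/seteqP; split => x [Xx] => [Vx|[]] //; split => //; split => //; apply: pXY.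
split; first by move=> x /pXY /pYZ.
  by move=> V oV; rewrite E; apply/oXY/oYZ.
by move=> V g oV rg; rewrite E; exact: (rXY _ _ (oYZ _ oV) (rYZ _ _ oV rg)).
Qed.

Lemma morphism_ext S T (X : fun_space C S) (Y : fun_space C T) phi psi :
  space_axioms X -> (forall x, fs_points X x -> phi x = psi x) ->
  is_morphism X Y phi -> is_morphism X Y psi.
Proof.
move=> HX pp [pX oX rX].
have E V : fs_points X `&` psi @^-1` V = fs_points X `&` phi @^-1` V.
  by apply/seteqP; split => x [Xx] /= Vx; split => //=; [rewrite pp|rewrite -pp].
split; first by move=> x Xx; rewrite -pp //; apply: pX.
  by move=> V oV; rewrite E; apply: oX.
move=> V g oV rg; rewrite E; apply: (reg_ext HX (oX _ oV) _ (rX _ _ oV rg)).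
by move=> x [Xx _] /=; rewrite pp.
Qed.

Lemma morphism_reg S T (X : fun_space C S) (Y : fun_space C T) phi g :
  space_axioms Y -> is_morphism X Y phi -> fs_reg Y (fs_points Y) g ->
  fs_reg X (fs_points X) (g \o phi).
Proof.
move=> HY [pX oX rX] rg; have := rX _ _ (open_points HY) rg.
rewrite (_ : _ `&` _ = fs_points X) //; apply/seteqP.
by split => [x []|x Xx] //; split => //; apply: pX.
Qed.

Section Restriction.
Variables (S S' T T' : Type) (X : fun_space C S') (Y : fun_space C T').
Variables (i : S -> S') (j : T -> T').
Hypothesis HX : space_axioms X.

(** Induced structures compose: both strata carry the structure of the
    ambient spaces, so a morphism of the large pieces restricts. *)
Lemma morphism_restrict (A A' : set S) (B B' : set T) phi :
  A' `<=` A -> (forall x, A x -> fs_points X (i x)) ->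
  B' `<=` B -> (forall y, B y -> fs_points Y (j y)) ->
  (forall x, A' x -> B' (phi x)) ->
  is_morphism (induced_space X i A) (induced_space Y j B) phi ->
  is_morphism (induced_space X i A') (induced_space Y j B') phi.
Proof.
move=> AA AX BB BY AB mphi.
have AX' x : A' x -> fs_points X (i x) by move=> /AA /AX.
have HA' : space_axioms (induced_space X i A') by apply: induced_space_axioms.
apply: morphism_to_induced => //.
apply: (morphism_comp (phi := phi) (Y := induced_space Y j B)); last exact: induced_morphism.
apply: (morphism_comp (phi := id) (psi := phi) (Y := induced_space X i A)) => //.
by apply: morphism_to_induced => //; apply: induced_morphism.
Qed.

End Restriction.

End SpacesWithFunctions.

(** * Dimensions of quotient spaces *)

Section QuotientDimension.
Variables (C : fieldType) (V : lmodType C).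
Implicit Types (L K : set V).

Lemma linear_subspace_sum L d (v : 'I_d -> V) (c : 'I_d -> C) :
  linear_subspace L -> (forall i, L (v i)) -> L (\sum_i c i *: v i).
Proof.
move=> [L0 Ll] Lv; elim/big_ind: _ => // [x y Lx Ly|i _].
  by rewrite -[x]scale1r; apply: Ll.
by rewrite -[_ *: _]addr0; apply: Ll.
Qed.

Lemma linear_subspaceB L x y : linear_subspace L -> L x -> L y -> L (x - y).
Proof. by move=> [_ Ll] Lx Ly; rewrite addrC -scaleN1r; apply: Ll. Qed.

Lemma linear_subspaceI L K :
  linear_subspace L -> linear_subspace K -> linear_subspace (L `&` K).
Proof.
by move=> [L0 Ll] [K0 Kl]; split => // a x y [? ?] [? ?]; split; [apply: Ll|apply: Kl].
Qed.

Lemma linear_subspace0 : linear_subspace [set (0 : V)].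
Proof. by split => // a x y /= -> ->; rewrite scaler0 addr0. Qed.

Lemma quot_dim_eq_mx L K d d' (v : 'I_d -> V) (w : 'I_d' -> V) :
  (forall i, L (v i)) ->
  (forall x, L x -> exists! c : 'rV[C]_d', K (x - \sum_i c 0 i *: w i)) ->
  exists A : 'M[C]_(d, d'), forall i, K (v i - \sum_j A i j *: w j).
Proof.
move=> Lv Hw.
have /choice[a Ha] : forall i, exists c : 'rV[C]_d', K (v i - \sum_j c 0 j *: w j).
  by move=> i; have [c [Hc _]] := Hw _ (Lv i); exists c.
exists (\matrix_(i, j) a i 0 j) => i; have := Ha i; congr (K (_ - _)).
by apply: eq_bigr => j _; rewrite mxE.
Qed.

(** Expressing v by w and then w by v modulo K yields v itself, whose
    coordinates are unique; so the two transition matrices are inverse to each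
    other. *)
Lemma quot_dim_eq_mulmx L K d d' (v : 'I_d -> V) (w : 'I_d' -> V)
    (A : 'M[C]_(d, d')) (B : 'M[C]_(d', d)) :
  linear_subspace K -> (forall i, L (v i)) ->
  (forall x, L x -> exists! c : 'rV[C]_d, K (x - \sum_i c 0 i *: v i)) ->
  (forall i, K (v i - \sum_j A i j *: w j)) ->
  (forall j, K (w j - \sum_i B j i *: v i)) -> A *m B = 1%:M.
Proof.
move=> HK Lv Hv HA HB; apply/row_matrixP => i.
have [c [_ Hc]] := Hv _ (Lv i); transitivity c; last first.
  apply: Hc; rewrite (bigD1 i) //= big1 ?addr0.
    by rewrite !mxE eqxx scale1r subrr; case: HK.
  by move=> j ji; rewrite !mxE eq_sym (negbTE ji) scale0r.
apply/esym/Hc.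
have -> : v i - \sum_l row i (A *m B) 0 l *: v l =
   (v i - \sum_j A i j *: w j) + \sum_j A i j *: (w j - \sum_l B j l *: v l).
  rewrite [X in _ = _ + X]
    (eq_bigr (fun j => A i j *: w j - A i j *: \sum_l B j l *: v l)); last first.
    by move=> j _; rewrite scalerBr.
  rewrite sumrB addrA subrK; congr (_ - _).
  rewrite [LHS](eq_bigr (fun l => \sum_j A i j *: (B j l *: v l))); last first.
    by move=> l _; rewrite !mxE scaler_suml; apply: eq_bigr => j _; rewrite scalerA.
  by rewrite exchange_big; apply: eq_bigr => j _; rewrite scaler_sumr.
by rewrite -[X in K (X + _)]scale1r; case: (HK) => _; apply => //; apply: linear_subspace_sum.
Qed.

Lemma quot_dim_eq_uniq L K d d' : linear_subspace K ->
  quot_dim_eq L K d -> quot_dim_eq L K d' -> d = d'.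
Proof.
move=> HK [v [Lv Hv]] [w [Lw Hw]].
have [A HA] := quot_dim_eq_mx Lv Hw; have [B HB] := quot_dim_eq_mx Lw Hv.
apply/anti_leq; rewrite (mulmx1_min (quot_dim_eq_mulmx HK Lv Hv HA HB)).
by rewrite (mulmx1_min (quot_dim_eq_mulmx HK Lw Hw HB HA)).
Qed.

Lemma quot_dimE L K d : linear_subspace K -> quot_dim_eq L K d -> quot_dim L K = d.
Proof.
move=> HK Hd; rewrite /quot_dim; case: xgetP => [e _ He|/(_ d)] //.
exact: quot_dim_eq_uniq HK He Hd.
Qed.

(** Finiteness cannot be dropped: [quot_dim] is 0 also for infinite
    dimensions. *)
Lemma quot_dim_eq0 L K : fin_codim L K -> linear_subspace K ->
  quot_dim L K = 0 -> L `<=` K.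
Proof.
move=> [d Hd] HK; rewrite (quot_dimE HK Hd) => d0; subst d.
move: Hd => [v [_ Hv]] x Lx; have [c [Hc _]] := Hv x Lx.
by rewrite big_ord0 subr0 in Hc.
Qed.

(** How all dimensions below are computed: a linear map F on L with kernel K
    identifies L / K with a space of row vectors, here the row space of A. *)
Lemma quot_dim_eq_rank m q (A : 'M[C]_(m, q)) (F : V -> 'rV[C]_q) L K :
  linear_subspace L ->
  (forall a x y, F (a *: x + y) = a *: F x + F y) ->
  (forall x, L x -> (F x <= A)%MS) ->
  (forall y, (y <= A)%MS -> exists2 x, L x & F x = y) ->
  (forall x, K x <-> L x /\ F x = 0) ->
  quot_dim_eq L K (\rank A).
Proof.
move=> HL Fl LF FL HK.
have F0 : F 0 = 0.
  by have := Fl (-1) 0 0; rewrite scaler0 addr0 scaleN1r addNr.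
have Fsum d (v : 'I_d -> V) (c : 'I_d -> C) :
    F (\sum_i c i *: v i) = \sum_i c i *: F (v i).
  elim/big_ind2: _ => // [_ x _ y <- <-|i _].
    by rewrite -[x in LHS]scale1r Fl scale1r.
  by rewrite -[_ *: v i]addr0 Fl F0 addr0.
have /choice[v Hv] : forall i, exists x, L x /\ F x = row i (row_base A).
  move=> i; have [|x Lx Fx] := FL (row i (row_base A)); last by exists x.
  by rewrite (submx_trans (row_sub _ _)) ?eq_row_base.
exists v; split; first by move=> i; case: (Hv i).
have HF x (c : 'rV_(\rank A)) : L x ->
    K (x - \sum_i c 0 i *: v i) <-> F x = c *m row_base A.
  move=> Lx; rewrite HK.
  have -> : F (x - \sum_i c 0 i *: v i) = F x - c *m row_base A.
    rewrite addrC -scaleN1r Fl scaleN1r addrC Fsum mulmx_sum_row.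
    by congr (_ - _); apply: eq_bigr => i _; have [_ ->] := Hv i.
  split => [[_ /subr0_eq]//|->]; rewrite subrr; split => //.
  apply: linear_subspaceB => //; apply: linear_subspace_sum => // i.
  by case: (Hv i).
move=> x Lx; have /submxP[c Hc] : (F x <= row_base A)%MS.
  by rewrite eq_row_base LF.
exists c; split; first by apply/HF.
move=> c' /HF -/(_ Lx); rewrite Hc; apply: row_free_inj.
exact: row_base_free.
Qed.

End QuotientDimension.

(** * Row spaces and masked columns *)

Section RowSpaces.
Variable C : fieldType.

(** A matrix of largest rank among those with row space inside S has row
    space S. *)
Lemma exists_mx_of_subspace n (S : set 'rV[C]_n) : linear_subspace S ->
  exists d (A : 'M[C]_(d, n)), row_free A /\ forall x, S x <-> (x <= A)%MS.
Proof.
move=> [S0 Sl].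
pose P r := `[< exists A : 'M[C]_n, \rank A = r /\ forall y : 'rV_n, (y <= A)%MS -> S y >].
have P0 : exists r, P r.
  exists 0%N; apply/asboolP; exists 0; split; first exact: mxrank0.
  by move=> y /submx0null ->.
have Pn r : P r -> (r <= n)%N.
  by move=> /asboolP[A [<- _]]; apply: rank_leq_row.
case: (ex_maxnP P0 Pn) => r /asboolP[A [rA SA]] rmax.
exists (\rank A), (row_base A); split; first exact: row_base_free.
move=> x; rewrite eq_row_base; split; last exact: SA.
move=> Sx; have /rmax : P (\rank (A + x)%MS).
  apply/asboolP; exists (A + x)%MS; split => // y /sub_addsmxP[[u c] -> /=].
  rewrite [c]mx11_scalar mul_scalar_mx addrC; apply: Sl => //.
  exact/SA/submxMl.
rewrite -rA => le; rewrite (submx_trans (addsmxSr A x)) //.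
by have := mxrank_leqif_sup (addsmxSl A x) => /geq_leqif <-.
Qed.

(** Ranks are compared through left kernels, which makes sense for matrices
    of different widths. *)
Lemma mxrank_eq_ker m p q (A : 'M[C]_(m, p)) (B : 'M[C]_(m, q)) :
  (forall u : 'rV_m, u *m A = 0 <-> u *m B = 0) -> \rank A = \rank B.
Proof.
move=> H.
have: \rank (kermx A) = \rank (kermx B).
  apply/eqmx_rank/andP; split; apply/rV_subP => u.
    by move=> /sub_kermxP /H /sub_kermxP.
  by move=> /sub_kermxP /H /sub_kermxP.
rewrite !mxrank_ker; have := rank_leq_row A; have := rank_leq_row B; lia.
Qed.

(** Masking keeps the size of the matrix, in contrast with extracting the
    columns in S; the rank is the same. *)
Definition mask p q (S : pred 'I_q) (A : 'M[C]_(p, q)) : 'M[C]_(p, q) :=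
  \matrix_(r, c) (if S c then A r c else 0).

Lemma mask_mul m p q (S : pred 'I_q) (u : 'M[C]_(m, p)) (A : 'M[C]_(p, q)) :
  u *m mask S A = mask S (u *m A).
Proof.
apply/matrixP => i j; rewrite !mxE; case: ifP => Sj.
  by apply: eq_bigr => l _; rewrite mxE Sj.
by apply: big1 => l _; rewrite mxE Sj mulr0.
Qed.

Lemma mask_eq0 p q (S : pred 'I_q) (A : 'M[C]_(p, q)) :
  mask S A = 0 <-> forall r c, S c -> A r c = 0.
Proof.
split => [/matrixP H r c Sc|H]; first by have := H r c; rewrite !mxE Sc.
by apply/matrixP => r c; rewrite !mxE; case: ifP => // /H ->.
Qed.

Lemma maskT p q (S : pred 'I_q) (A : 'M[C]_(p, q)) :
  (forall c, S c) -> mask S A = A.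
Proof. by move=> H; apply/matrixP => r c; rewrite mxE H. Qed.

Lemma mask_submx m p q (S : pred 'I_q) (A : 'M[C]_(m, q)) (B : 'M[C]_(p, q)) :
  (A <= B)%MS -> (mask S A <= mask S B)%MS.
Proof. by move=> /submxP[u ->]; rewrite -mask_mul submxMl. Qed.

End RowSpaces.

(** * Lattices that contain C[[t^-1]] *)

Section Lattices.
Variable C : fieldType.
Implicit Types (x y : formal C).

Definition positive_part q (x : formal C) : 'rV[C]_q := \row_(c < q) (x c.+1%:Z : C).

(** The lattice between C[[t^-1]] and t^q C[[t^-1]] whose image in the
    quotient is the row space of A, column c standing for t^(c + 1). *)
Definition lattice_of d q (A : 'M[C]_(d, q)) : set (formal C) :=
  [set x | tpow_series q%:Z x /\ (positive_part q x <= A)%MS].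

(** The combination of t^1, ..., t^q with coefficients y. *)
Definition poly_of q (y : 'rV[C]_q) : formal C :=
  fun j => if insub (absz (j - 1)) is Some c then (if 0 < j then y 0 c else 0) else 0.

Lemma poly_of_nat q (y : 'rV[C]_q) (c : 'I_q) : poly_of y c.+1%:Z = y 0 c.
Proof.
rewrite /poly_of; have -> : absz (c.+1%:Z - 1) = c by lia.
by rewrite valK.
Qed.

Lemma poly_of_le0 q (y : 'rV[C]_q) j : j <= 0 -> poly_of y j = 0.
Proof. by move=> j0; rewrite /poly_of; case: insubP => // c; rewrite ltNge j0. Qed.

Lemma poly_of_gt q (y : 'rV[C]_q) j : q%:Z < j -> poly_of y j = 0.
Proof. by move=> j0; rewrite /poly_of; case: insubP => // c; lia. Qed.

Lemma positive_partK q (y : 'rV[C]_q) : positive_part q (poly_of y) = y.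
Proof. by apply/rowP => c; rewrite mxE poly_of_nat. Qed.

Lemma positive_part_linear q a x y :
  positive_part q (a *: x + y) = a *: positive_part q x + positive_part q y.
Proof. by apply/rowP => c; rewrite !mxE. Qed.

Lemma positive_partP q x j : 0 < j <= q%:Z -> exists2 c : 'I_q, j = c.+1%:Z &
  x j = positive_part q x 0 c.
Proof.
move=> jq; have lt : (absz (j - 1) < q)%N by lia.
exists (Ordinal lt) => /=; first by lia.
by rewrite mxE /=; congr x; lia.
Qed.

Lemma tpow_series_subspace m : linear_subspace (@tpow_series C m).
Proof.
split; first by [].
move=> a x y Lx Ly j mj; rewrite -[LHS]/(a *: x j + y j).
by rewrite Lx // Ly // scaler0 addr0.
Qed.

Lemma laurent_subspace : linear_subspace (@laurent C).
Proof.
split; first by exists 0.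
move=> a x y [N Lx] [M Ly]; exists (Num.max N M) => j.
rewrite gt_max => /andP[Nj Mj]; rewrite -[LHS]/(a *: x j + y j).
by rewrite Lx // Ly // scaler0 addr0.
Qed.

Lemma tpow_poly_subspace m : linear_subspace (@tpow_poly C m).
Proof.
split; first by split => //; case: laurent_subspace.
move=> a x y [Lx xm] [Ly ym]; split; first by apply: (laurent_subspace.2).
move=> j mj; rewrite -[LHS]/(a *: x j + y j).
by rewrite xm // ym // scaler0 addr0.
Qed.

Section Lattice.
Variables (d q : nat) (A : 'M[C]_(d, q)).

Lemma lattice_of_subspace : linear_subspace (lattice_of A).
Proof.
split.
  split => //; rewrite (_ : positive_part _ _ = 0) ?sub0mx //.
  by apply/rowP => c; rewrite !mxE.
move=> a x y [Lx xA] [Ly yA]; split; first exact: (tpow_series_subspace _).2.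
by rewrite positive_part_linear addmx_sub ?scalemx_sub.
Qed.

Lemma lattice_of_laurent : lattice_of A `<=` laurent (C := C).
Proof. by move=> x [xq _]; exists q%:Z. Qed.

Lemma series_sub_lattice_of : series (C := C) `<=` lattice_of A.
Proof.
move=> x x0; split; first by move=> j qj; apply: x0; lia.
rewrite (_ : positive_part _ _ = 0) ?sub0mx //.
by apply/rowP => c; rewrite !mxE; apply: x0; lia.
Qed.

Lemma poly_of_lattice (y : 'rV_q) : (y <= A)%MS -> lattice_of A (poly_of y).
Proof. by move=> yA; split; [move=> j; apply: poly_of_gt|rewrite positive_partK]. Qed.

Lemma quot_dim_series_pos (m : nat) :
  quot_dim_eq (lattice_of A) (lattice_of A `&` tpow_series m%:Z)
    (\rank (mask (fun c : 'I_q => (m <= c)%N) A)).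
Proof.
apply: (@quot_dim_eq_rank _ _ _ _ _
  (fun x => mask (fun c : 'I_q => (m <= c)%N) (positive_part q x))).
- exact: lattice_of_subspace.
- move=> a x y; rewrite positive_part_linear; apply/rowP => c; rewrite !mxE.
  by case: ifP => //; rewrite mulr0 addr0.
- by move=> x [_ xA]; apply: mask_submx.
- move=> y /submxP[u ->]; exists (poly_of (u *m A)); first exact/poly_of_lattice/submxMl.
  by rewrite positive_partK mask_mul.
- move=> x; split=> [[Lx xm]|[Lx /mask_eq0 xm]]; split => //.
    by apply/mask_eq0 => r c mc; rewrite mxE; apply: xm; lia.
  move=> j mj; case: (ltP q%:Z j) => [|jq]; first by case: Lx => + _; apply.
  have [|c cj ->] := @positive_partP q x j; first by lia.
  by apply: xm; lia.
Qed.

(** Elements of the lattice in t^(m + 1) C[t] are the vectors u A of which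
    the first m coordinates vanish, that is with u in the kernel of the masked
    matrix. *)
Lemma subspace_dim_poly_pos (m : nat) :
  subspace_dim (lattice_of A `&` tpow_poly m.+1%:Z) =
    (\rank A - \rank (mask (fun c : 'I_q => (c < m)%N) A))%N.
Proof.
set S := fun c : 'I_q => (c < m)%N.
have -> : (\rank A - \rank (mask S A))%N = \rank (kermx (mask S A) *m A).
  have := mxrank_mul_ker (kermx (mask S A)) A.
  have -> : (kermx (mask S A) :&: kermx A :=: kermx A)%MS.
    apply/capmx_idPr/rV_subP => u /sub_kermxP uA; apply/sub_kermxP.
    by rewrite mask_mul uA; apply/mask_eq0 => *; rewrite mxE.
  rewrite !mxrank_ker; have := rank_leq_row A; have := rank_leq_row (mask S A).
  have : (\rank (mask S A) <= \rank A)%N.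
    have -> : mask S A = A *m mask S 1%:M by rewrite mask_mul mulmx1.
    exact: mxrankM_maxl.
  lia.
apply: quot_dimE; first exact: linear_subspace0.
have HL : linear_subspace (lattice_of A `&` tpow_poly m.+1%:Z).
  apply: linear_subspaceI; first exact: lattice_of_subspace.
  exact: tpow_poly_subspace.
apply: (@quot_dim_eq_rank _ _ _ _ _ (positive_part q)) => //.
- exact: positive_part_linear.
- move=> x [[_ /submxP[u xA]] [_ xm]]; rewrite xA submxMr //.
  apply/sub_kermxP; rewrite mask_mul -xA; apply/mask_eq0 => r c Sc.
  by rewrite mxE; apply: xm; move: Sc; rewrite /S; lia.
- move=> y /submxP[u yA]; exists (poly_of y); last exact: positive_partK.
  have Ly : lattice_of A (poly_of y).
    by apply: poly_of_lattice; rewrite yA mulmxA submxMl.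
  split => //; split; first exact: lattice_of_laurent Ly.
  move=> j jm; case: (leP j 0) => [|j0]; first exact: poly_of_le0.
  case: (ltP q%:Z j) => [|jq]; first exact: poly_of_gt.
  have [|c cj ->] := @positive_partP q (poly_of y) j; first by lia.
  rewrite positive_partK yA.
  have /mask_eq0 : mask S (u *m (kermx (mask S A) *m A)) = 0.
    by rewrite -!mask_mul mulmx_ker mulmx0.
  by apply; rewrite /S; lia.
- move=> x; split => [->|[[[xq xA] [_ xm]] x0]] /=.
    split; first by case: HL.
    by apply/rowP => c; rewrite !mxE.
  apply/funext => j; rewrite -[RHS]/(0 : C^o).
  case: (leP j 0) => j0; first by apply: xm; lia.
  case: (ltP q%:Z j) => [|jq]; first exact: xq.
  have [|c cj ->] := @positive_partP q x j; first by lia.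
  by rewrite x0 mxE.
Qed.

Lemma rank_block_1 p : \rank (block_mx (1%:M : 'M_p) 0 0 A) = (\rank A + p)%N.
Proof. by rewrite rank_diag_block_mx mxrank1 addnC. Qed.

Lemma submx_block_1 p (a : 'rV[C]_p) (b : 'rV_q) :
  (row_mx a b <= block_mx (1%:M : 'M_p) 0 0 A)%MS = (b <= A)%MS.
Proof.
apply/submxP/submxP => [[u]|[u ->]].
  rewrite -[u]hsubmxK mul_row_block => /eq_row_mx[_].
  by rewrite mulmx0 add0r => ->; exists (rsubmx u).
by exists (row_mx a u); rewrite mul_row_block !mulmx0 mulmx1 addr0 add0r.
Qed.

(** The coefficients of t^0, t^-1, ..., t^(1 - p); they are unconstrained in
    a lattice that contains C[[t^-1]], which explains the identity block in the
    lemmas below. *)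
Definition nonpos_part p (x : formal C) : 'rV[C]_p := \row_(c < p) (x (- c%:Z) : C).

Lemma truncation_linear p a x y :
  row_mx (nonpos_part p (a *: x + y)) (positive_part q (a *: x + y)) =
  a *: row_mx (nonpos_part p x) (positive_part q x) +
  row_mx (nonpos_part p y) (positive_part q y).
Proof.
rewrite scale_row_mx add_row_mx positive_part_linear; congr row_mx.
by apply/rowP => c; rewrite !mxE.
Qed.

Lemma truncation_surj p (y : 'rV[C]_(p + q)) :
  (y <= block_mx (1%:M : 'M_p) 0 0 A)%MS ->
  exists2 x, (lattice_of A `&` tpow_poly (1 - p%:Z)) x &
    row_mx (nonpos_part p x) (positive_part q x) = y.
Proof.
rewrite -[y]hsubmxK submx_block_1; set a := lsubmx y; set b := rsubmx y => bA.
pose x : formal C := fun j => if 0 < j then poly_of b j else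
  if insub (absz j) is Some c then a 0 c else 0.
have xb : positive_part q x = b.
  by rewrite -[RHS]positive_partK; apply/rowP => c; rewrite !mxE.
have Lx : lattice_of A x.
  split; last by rewrite xb.
  move=> j qj; rewrite /x; case: ifP => [_|]; first exact: poly_of_gt.
  by lia.
exists x.
  split => //; split; first exact: lattice_of_laurent Lx.
  move=> j jp; rewrite /x; case: ifP => j0; first by rewrite poly_of_le0 //; lia.
  by case: insubP => // c; lia.
congr row_mx => //; apply/rowP => c; rewrite mxE /x.
have -> : (0 < - c%:Z :> int) = false by lia.
have -> : absz (- c%:Z) = c by lia.
by rewrite valK.
Qed.

Lemma quot_dim_series_neg (p : nat) :
  quot_dim_eq (lattice_of A) (lattice_of A `&` tpow_series (- p%:Z)) (\rank A + p).
Proof.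
rewrite -rank_block_1.
apply: (@quot_dim_eq_rank _ _ _ _ _
   (fun x => row_mx (nonpos_part p x) (positive_part q x))).
- exact: lattice_of_subspace.
- exact: truncation_linear.
- by move=> x [_ xA]; rewrite submx_block_1.
- by move=> y /truncation_surj[x [Lx _] <-]; exists x.
- move=> x; split=> [[Lx xm]|[Lx E]]; split => //.
    by rewrite -row_mx0; congr row_mx; apply/rowP => c; rewrite !mxE; apply: xm;
    have := ltn_ord c; lia.
  move: E; rewrite -row_mx0 => /eq_row_mx[x0 x1].
  move=> j mj; case: (ltP q%:Z j) => [|jq]; first by case: Lx => + _; apply.
  case: (ltP 0 j) => j0.
    have [|c cj ->] := @positive_partP q x j; first by lia.
    by rewrite x1 mxE.
  have lt : (absz j < p)%N by lia.
  move/rowP: x0 => /(_ (Ordinal lt)); rewrite !mxE /= => <-; congr x; lia.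
Qed.

Lemma subspace_dim_poly_neg (p : nat) :
  subspace_dim (lattice_of A `&` tpow_poly (1 - p%:Z)) = (\rank A + p)%N.
Proof.
rewrite -rank_block_1; apply: quot_dimE; first exact: linear_subspace0.
have HL : linear_subspace (lattice_of A `&` tpow_poly (1 - p%:Z)).
  apply: linear_subspaceI; first exact: lattice_of_subspace.
  exact: tpow_poly_subspace.
apply: (@quot_dim_eq_rank _ _ _ _ _
   (fun x => row_mx (nonpos_part p x) (positive_part q x))) => //.
- exact: truncation_linear.
- by move=> x [[_ xA] _]; rewrite submx_block_1.
- exact: truncation_surj.
- move=> x; split => [->|[[[xq xA] [_ xm]]]] /=.
    split; first by case: HL.
    by rewrite -row_mx0; congr row_mx; apply/rowP => c; rewrite !mxE.
  rewrite -row_mx0 => /eq_row_mx[x0 x1].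
  apply/funext => j; rewrite -[RHS]/(0 : C^o).
  case: (ltP q%:Z j) => [|jq]; first exact: xq.
  case: (ltP 0 j) => j0.
    have [|c cj ->] := @positive_partP q x j; first by lia.
    by rewrite x1 mxE.
  case: (ltP j (1 - p%:Z)) => jp; first exact: xm.
  have lt : (absz j < p)%N by lia.
  move/rowP: x0 => /(_ (Ordinal lt)); rewrite !mxE /= => <-; congr x; lia.
Qed.

End Lattice.

Lemma lattice_of_window (L : set (formal C)) q : linear_subspace L ->
  series (C := C) `<=` L -> L `<=` tpow_series q%:Z ->
  exists d (A : 'M[C]_(d, q)), row_free A /\ L = lattice_of A.
Proof.
move=> HL sL Lq.
have [|d [A [fA HA]]] := @exists_mx_of_subspace C q (positive_part q @` L).
  split.
    by exists 0; [case: HL|apply/rowP => c; rewrite !mxE].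
  move=> a _ _ [x Lx <-] [y Ly <-]; exists (a *: x + y); first exact: HL.2.
  exact: positive_part_linear.
exists d, A; split => //; apply/seteqP; split => x.
  by move=> Lx; split; [apply: Lq|apply/HA; exists x].
move=> [xq /HA[y Ly xy]].
have -> : x = 1 *: (x - y) + y by rewrite scale1r subrK.
apply: HL.2 => //; apply: sL => j j0.
rewrite -[LHS]/(x j - y j).
case: (ltP q%:Z j) => jq; first by rewrite xq // (Lq y) // subrr.
have [|c cj xj] := @positive_partP q x j; first by lia.
have [|c' cj' yj] := @positive_partP q y j; first by lia.
by rewrite xj yj xy (_ : c = c') ?subrr //; apply: ord_inj; lia.
Qed.

(** The series part is bounded by 0, and finitely many Laurent series
    generate the rest. *)
Lemma lattice_bounded (L : set (formal C)) : lattice L ->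
  exists q : nat, L `<=` tpow_series q%:Z.
Proof.
move=> [_ Ll [d [v [Lv Hv]]] _].
have /choice[N HN] : forall i, exists N, forall j, N < j -> v i j = 0.
  by move=> i; apply: Ll.
have NM i : (absz (N i) <= \max_l absz (N l))%N by apply: leq_bigmax.
move: (\max_l absz (N l)) NM => M NM; exists M => x Lx j qj.
have [c [[_ /(_ j) Hc] _]] := Hv x Lx.
have vj i : v i j = 0.
  by apply: HN; have := NM i; lia.
have : (x - \sum_i c 0 i *: v i) j = 0 by apply: Hc; lia.
rewrite -[LHS]/(x j - (\sum_i c 0 i *: v i) j).
have -> : (\sum_i c 0 i *: v i) j = 0.
  rewrite fct_sumE big1 // => i _.
  by rewrite -[LHS]/(c 0 i *: v i j) vj scaler0.
by rewrite subr0.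
Qed.

(** The index and the dimension at m = 0 together force L to contain
    C[[t^-1]].  The dimension at m = n bounds L by t^n C[[t^-1]] only once L is
    known to lie in some t^q C[[t^-1]], because an infinite dimension would
    also be recorded as 0. *)
Lemma lattice_ofP (L : set (formal C)) n k : lattice L -> lattice_index L = k%:Z ->
  quot_dim L (L `&` tpow_series 0) = k ->
  quot_dim L (L `&` tpow_series n%:Z) = 0%N ->
  exists A : 'M[C]_(k, n), \rank A = k /\ L = lattice_of A.
Proof.
move=> latL; have [HL _ _ fs] := latL; rewrite /lattice_index => ind k0 n0.
have sL : series (C := C) `<=` L.
  have H : linear_subspace (L `&` series (C := C)).
    by apply: linear_subspaceI => //; apply: tpow_series_subspace.
  move=> x /(quot_dim_eq0 fs H) -[] //; move: ind.
  by rewrite k0; lia.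
have [q Lq] := lattice_bounded latL.
have [d [A [_ LA]]] := lattice_of_window HL sL Lq.
have Ln : L `<=` tpow_series n%:Z.
  have := n0; rewrite LA (quot_dimE _ (quot_dim_series_pos A n)); last first.
    by apply: linear_subspaceI; [apply: lattice_of_subspace|apply: tpow_series_subspace].
  move=> /eqP; rewrite mxrank_eq0 => /eqP A0 x [xq /submxP[u xA]] j nj.
  case: (ltP q%:Z j) => jq; first exact: xq.
  have [|c cj ->] := @positive_partP q x j; first by lia.
  have /mask_eq0 : mask (fun c : 'I_q => (n <= c)%N) (positive_part q x) = 0.
    by rewrite xA -mask_mul A0 mulmx0.
  by apply; lia.
have [d' [B [fB LB]]] := lattice_of_window HL sL Ln.
have dk : d' = k.
  have := k0; rewrite LB (quot_dimE _ (quot_dim_series_pos B 0)); last first.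
    by apply: linear_subspaceI; [apply: lattice_of_subspace|apply: tpow_series_subspace].
  by rewrite maskT // (eqP fB).
by subst d'; exists B; split => //; apply/eqP.
Qed.

End Lattices.

(** * Counting balls in juggling patterns *)

Lemma sum_period (n : nat) (d : int -> int) (i j : int) :
  (forall a, d (a + n%:Z) = d a) ->
  \sum_(s < n) d (i + s%:Z) = \sum_(s < n) d (j + s%:Z).
Proof.
move=> dn.
have step a : \sum_(s < n) d (a + 1 + s%:Z) = \sum_(s < n) d (a + s%:Z).
  (* Both sides become the sum of d over the n + 1 integers a, ..., a + n. *)
  apply: (@addrI _ (d a)).
  transitivity (\sum_(s < n.+1) d (a + s%:Z)).
    rewrite big_ord_recl /= addr0; congr (_ + _); apply: eq_bigr => s _.
    by congr d; rewrite ?lift0 /bump /=; lia.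
  by rewrite big_ord_recr /= dn addrC.
suff H a : \sum_(s < n) d (a + s%:Z) = \sum_(s < n) d (0 + s%:Z).
  by rewrite H [RHS]H.
elim/int_ind: a => // m IH.
  by rewrite -IH -(step m%:Z); apply: eq_bigr => s _; congr d; lia.
by rewrite -IH -(step (- m.+1%:Z)); apply: eq_bigr => s _; congr d; lia.
Qed.

Section Juggling.
Variables (n k : nat) (f g : int -> int).
Hypotheses (n_gt0 : (0 < n)%N) (jf : bounded_juggling n k f).
Hypotheses (fK : cancel f g) (gK : cancel g f).

Let fn (a : int) : f (a + n%:Z) = f a + n%:Z. Proof. by case: jf => -[]. Qed.
Let fb (a : int) : a <= f a <= a + n%:Z. Proof. by case: jf. Qed.
Let gb (a : int) : a - n%:Z <= g a <= a. Proof. by have := fb (g a); rewrite gK; lia. Qed.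

Lemma sum_throws : \sum_(1 <= a < n.+1) (f a%:Z - a%:Z) = (n * k)%:Z.
Proof.
case: jf => _ + _; rewrite /balls => /(congr1 (fun x => n%:Q * x)).
rewrite mulVKf ?intr_eq0 ?eqz_nat -?lt0n // -intrM => /intr_inj ->.
by rewrite PoszM.
Qed.

(** The positions of the window that starts at i are hit by the balls which
    are in the air at time i.  Modulo n, f permutes the times i, ...,
    i + n - 1; the value f (i + s) exceeds its residue by n exactly when the
    ball thrown at i + s is in the air at i + n.  Summing f (i + s) - (i + s)
    thus gives n times the number of such balls, and by definition n k. *)
Lemma card_balls_in_air (i : int) : #|[set c : 'I_n | g (i + c%:Z) < i]%SET| = k.
Proof.
(* v s is f (i + s) - i reduced modulo n, as f (i + s) < i + 2 n. *)
pose v (s : 'I_n) := f (i + s%:Z) - i - (if i + n%:Z <= f (i + s%:Z) then n%:Z else 0).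
have v_lt s : 0 <= v s < n%:Z.
  by rewrite /v; have := fb (i + s%:Z); have := ltn_ord s; case: ifP; lia.
pose p s := insubd s (absz (v s)).
have pE s : (p s)%:Z = v s.
  by rewrite val_insubd; have := v_lt s; case: ifP; lia.
have p_inj : injective p.
  move=> s t st; have : v s = v t by rewrite -!pE st.
  have E a b (x y : 'I_n) : f (i + x%:Z) + a * n%:Z = f (i + y%:Z) + b * n%:Z ->
     a = b -> x = y.
    move=> + ab; rewrite ab => /addIr /(can_inj fK) E; apply: ord_inj; lia.
  have ls := ltn_ord s; have lt := ltn_ord t.
  rewrite /v; case: ifP => sn; case: ifP => tn E'.
  - by apply: (E 0 0); lia.
  - have : f (i + s%:Z) = f (i + t%:Z + n%:Z) by rewrite fn; lia.
    by move=> /(can_inj fK); lia.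
  - have : f (i + s%:Z + n%:Z) = f (i + t%:Z) by rewrite fn; lia.
    by move=> /(can_inj fK); lia.
  - by apply: (E 0 0); lia.
have -> : [set c : 'I_n | g (i + c%:Z) < i]%SET =
          [set p s | s : 'I_n & i + n%:Z <= f (i + s%:Z)]%SET.
  apply/setP => c; rewrite inE; apply/idP/imsetP => [gi|[s]].
    have gc := gb (i + c%:Z).
    have lt : (absz (g (i + c%:Z) + n%:Z - i)%R < n)%N by have := ltn_ord c; lia.
    have fs : f (i + (Ordinal lt)%:Z) = i + c%:Z + n%:Z.
      by rewrite -[i + c%:Z in RHS]gK -fn; congr f => /=; lia.
    exists (Ordinal lt); first by rewrite inE fs; lia.
    apply: ord_inj; have := pE (Ordinal lt); rewrite /v fs; case: ifP; lia.
  rewrite inE => fs ->; rewrite pE /v fs.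
  have -> : i + (f (i + s%:Z) - i - n%:Z) = f (i + s%:Z - n%:Z).
    by apply: (@addIr _ n%:Z); rewrite -fn; rewrite subrK; lia.
  by rewrite fK; have := ltn_ord s; lia.
rewrite card_imset // -sum1_card.
have : \sum_(s < n) (f (i + s%:Z) - (i + s%:Z)) = (n * k)%:Z.
  rewrite (@sum_period n (fun a => f a - a) i 1); last by move=> a; rewrite fn; lia.
  rewrite -sum_throws big_add1 /= big_mkord; apply: eq_bigr => s _.
  by congr (f _ - _); lia.
rewrite (eq_bigr (fun s : 'I_n => ((p s)%:Z - s%:Z) +
    n%:Z * (nat_of_bool (i + n%:Z <= f (i + s%:Z))%R)%:Z)); last first.
  by move=> s _; rewrite pE /v; case: ifP; lia.
rewrite big_split /= sumrB [X in _ - X](reindex_inj p_inj) subrr add0r.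
rewrite -big_distrr /= -(big_morph Posz PoszD erefl) -PoszM => -[] /eqP.
rewrite eqn_pmul2l // => /eqP <-; rewrite big_mkcond; apply: eq_bigr => s _.
by rewrite inE; case: ifP.
Qed.

Lemma card_caught_later (i j : int) : i <= j + 1 ->
  #|` fset_set [set a : int | i <= a /\ f a <= j]| =
  (\sum_(c < absz (j - i + 1)%R) (i <= g (i + c%:Z))%R)%N.
Proof.
move=> ij; set l := absz _.
pose s := [seq g (i + c%:Z) | c <- iota 0 l & i <= g (i + c%:Z)].
have -> : [set a : int | i <= a /\ f a <= j] = [set` [fset a in s]%fset].
  apply/seteqP; split => a /=; rewrite in_fset /=.
    move=> [ia fj]; apply/mapP; exists (absz (f a - i)).
      have E : i + (absz (f a - i))%:Z = f a by have := fb a; lia.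
      rewrite mem_filter E fK ia mem_iota /l; have := fb a; lia.
    by rewrite -[LHS]fK; congr g; have := fb a; lia.
  move=> /mapP[c]; rewrite mem_filter mem_iota => /andP[ic cl] ->.
  by rewrite gK /l in cl *; split => //; lia.
rewrite set_fsetK card_fseq undup_id.
  rewrite size_map size_filter -sum1_count big_mkcond /=.
  have -> : iota 0 l = index_iota 0 l by rewrite /index_iota subn0.
  by rewrite big_mkord; apply: eq_bigr => c _; case: ifP.
rewrite map_inj_uniq ?filter_uniq ?iota_uniq //.
by move=> c d /(can_inj gK); lia.
Qed.

(** Each of the landing times i, ..., j is served by one ball, thrown either
    at time i or later, or before i.  For j = i + n the last landing time is of
    the first kind, since no throw lasts longer than n. *)
Lemma card_balls_below (i j : int) : i <= j <= i + n%:Z ->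
  (j - i + 1) - #|` fset_set [set a : int | i <= a /\ f a <= j]|%:Z =
  #|[set c : 'I_n | (c < absz (j - i + 1)%R)%N && (g (i + c%:Z) < i)%R]%SET|%:Z.
Proof.
move=> /andP[ij jn]; rewrite card_caught_later; last by lia.
set l := absz _; have -> : j - i + 1 = l%:Z by rewrite /l; lia.
have l_split : (\sum_(c < l) (i <= g (i + c%:Z))%R + \sum_(c < l) (g (i + c%:Z) < i)%R
    = l)%N.
  rewrite -big_split /= -[RHS](card_ord l) -sum1_card.
  by apply: eq_bigr => c _; case: leP.
suff -> : #|[set c : 'I_n | (c < l)%N && (g (i + c%:Z) < i)%R]%SET| =
    (\sum_(c < l) (g (i + c%:Z) < i)%R)%N by lia.
have -> : #|[set c : 'I_n | (c < l)%N && (g (i + c%:Z) < i)%R]%SET| =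
    (\sum_(c < n | (c < l)%N) (g (i + c%:Z) < i)%R)%N.
  rewrite -sum1_card [LHS]big_mkcond [RHS]big_mkcond; apply: eq_bigr => c _.
  by rewrite inE; case: (c < l)%N; case: (_ < i).
case: (leqP l n) => ln.
  exact/esym/(big_ord_widen n (fun c => nat_of_bool (g (i + c%:Z) < i)%R)).
have -> : l = n.+1 by rewrite /l in ln *; lia.
rewrite big_ord_recr /= [X in (_ + X)%N](_ : _ = 0%N).
  by rewrite addn0; apply: eq_bigl => c; rewrite ltnS ltnW.
by have := gb (i + n%:Z); case: ltP => //; lia.
Qed.

End Juggling.

(** * Coordinate subspaces *)

Section CoordinateSpaces.
Variables (C : fieldType) (n : nat).

Definition coord_mx (J : {set 'I_n}) : 'M[C]_n :=
  \matrix_(r, c) ((r == c) && (c \in J))%:R.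

Lemma coord_mx_mul p (u : 'M[C]_(p, n)) J r c :
  (u *m coord_mx J) r c = if c \in J then u r c else 0.
Proof.
rewrite mxE (bigD1 c) //= big1 ?addr0 => [|s sc].
  by rewrite mxE eqxx /=; case: (c \in J); rewrite ?mulr1 ?mulr0.
by rewrite mxE (negbTE sc) mulr0.
Qed.

Lemma sub_coord_mx p (u : 'M[C]_(p, n)) J :
  (u <= coord_mx J)%MS <-> forall r c, c \notin J -> u r c = 0.
Proof.
split => [/submxP[v ->] r c cJ|H]; first by rewrite coord_mx_mul (negbTE cJ).
apply/submxP; exists u; apply/matrixP => r c; rewrite coord_mx_mul.
by case: ifP => // /negbT /H ->.
Qed.

Definition select_mx p (e : 'I_p -> 'I_n) : 'M[C]_(p, n) :=
  \matrix_(r, c) (c == e r)%:R.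

Lemma eqmx_select_coord p (e : 'I_p -> 'I_n) :
  (select_mx e :=: coord_mx [set e r | r : 'I_p]%SET)%MS.
Proof.
apply/eqmxP/andP; split.
  apply/sub_coord_mx => r c; rewrite mxE; case: eqP => // -> /imsetP[].
  by exists r.
apply/row_subP => c; case: (boolP (c \in [set e r | r : 'I_p]%SET)).
  move=> /imsetP[r _ ->]; rewrite (_ : row _ _ = row r (select_mx e)) ?row_sub //.
  apply/rowP => d; rewrite !mxE eq_sym; case: eqP => // -> /=.
  by rewrite imset_f.
move=> cJ; rewrite (_ : row _ _ = 0) ?sub0mx //.
by apply/rowP => d; rewrite !mxE; case: eqP => // <-; rewrite (negbTE cJ).
Qed.

Lemma rank_normalized p (e : 'I_p -> 'I_n) (A : 'M[C]_(p, n)) :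
  colsub e A = 1%:M -> \rank A = p.
Proof.
move=> Ae; apply/eqP; rewrite eqn_leq rank_leq_row -{1}(mxrank1 C p) -Ae.
have -> : colsub e A = A *m colsub e 1%:M by rewrite mulmx_colsub mulmx1.
exact: mxrankM_maxl.
Qed.

Lemma rank_coord_mx J : \rank (coord_mx J) = #|J|.
Proof.
have -> : J = [set enum_val r | r : 'I_#|J|]%SET.
  apply/setP => c; apply/idP/imsetP => [cJ|[r _ ->]]; last exact: enum_valP.
  by exists (enum_rank_in cJ c) => //; rewrite enum_rankK_in.
rewrite -(eqmx_select_coord _).
rewrite card_imset ?card_ord; last exact: enum_val_inj.
apply: (@rank_normalized _ enum_val); apply/matrixP => r s; rewrite !mxE.
by rewrite (inj_eq enum_val_inj) eq_sym.
Qed.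

Lemma mask_coord_mx (S : pred 'I_n) J :
  mask S (coord_mx J) = coord_mx [set c in J | S c]%SET.
Proof.
apply/matrixP => r c; rewrite !mxE !inE; case: (S c); first by rewrite andbT.
by rewrite !andbF.
Qed.

Lemma eqmx_lattice_of p q (A : 'M[C]_(p, n)) (B : 'M[C]_(q, n)) :
  (A :=: B)%MS -> lattice_of A = lattice_of B.
Proof.
by move=> AB; apply/seteqP; split => x [xn xA]; split => //; move: xA; rewrite AB.
Qed.

(** A coordinate lattice between C[[t^-1]] and t^n C[[t^-1]] is determined by
    the set of its exponents in 1, ..., n. *)
Lemma coord_flagE (f : int -> int) (i : int) (J : {set 'I_n}) :
  (forall j, j <= 0 -> exists2 a : int, f a = i + j - 1 & a < i) ->
  (forall a, a < i -> f a < i + n%:Z) ->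
  (forall c : 'I_n, c \in J <-> exists2 a : int, f a = i + c%:Z & a < i) ->
  @coord_flag C f i = lattice_of (coord_mx J).
Proof.
move=> fneg fn fJ; apply/seteqP; split => x.
  move=> [_ Hx]; split.
    move=> j nj; apply/eqP/negbNE/negP => /Hx[a fa ai].
    by have := fn a ai; rewrite fa; lia.
  apply/sub_coord_mx => r c cJ; rewrite mxE.
  apply/eqP/negbNE/negP => /Hx[a fa ai].
  by case/negP: cJ; apply/fJ; exists a => //; rewrite fa; lia.
move=> [xn /sub_coord_mx Hx]; split; first by exists n%:Z.
move=> j xj; case: (leP j 0) => [|j0]; first exact: fneg.
case: (leP j n%:Z) => jn; last by rewrite xn ?eqxx in xj.
have [|c cj xc] := @positive_partP C n x j; first by lia.
have /fJ[a fa ai] : c \in J.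
  by apply/negbNE/negP => /(Hx 0) x0; rewrite xc x0 eqxx in xj.
by exists a => //; rewrite fa cj; lia.
Qed.

End CoordinateSpaces.

(** * Echelon forms with prescribed pivots *)

Section Echelon.
Variables (C : fieldType) (k n : nat).
Implicit Types (A : 'M[C]_(k, n)) (e : 'I_k -> 'I_n).

Notation from p := (fun c : 'I_n => (p <= c)%N).

Lemma normalizedE e A r s : colsub e A = 1%:M -> A r (e s) = (r == s)%:R.
Proof. by move=> /matrixP/(_ r s); rewrite !mxE. Qed.

Lemma normalized_coef e A (u : 'rV_k) s : colsub e A = 1%:M ->
  (u *m A) 0 (e s) = u 0 s.
Proof.
move=> Ae; rewrite mxE (bigD1 s) //= big1 => [|r rs].
  by rewrite (normalizedE _ _ Ae) eqxx mulr1 addr0.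
by rewrite (normalizedE _ _ Ae) (negbTE rs) mulr0.
Qed.

Lemma normalized_sub e A (y : 'rV_n) c : colsub e A = 1%:M -> (y <= A)%MS ->
  y 0 c = \sum_s y 0 (e s) * A s c.
Proof.
move=> Ae /submxP[u ->]; rewrite [LHS]mxE; apply: eq_bigr => s _.
by rewrite (normalized_coef _ _ Ae).
Qed.

(** The pivot of row r, in column e r, is the last nonzero entry of the row:
    echelon forms follow leading exponents, hence are aligned on the right. *)
Definition echelon e A :=
  colsub e A = 1%:M /\ forall r (c : 'I_n), (e r < c)%N -> A r c = 0.

Lemma echelon_ker e A p (u : 'rV_k) : echelon e A ->
  u *m mask (from p) A = 0 <-> forall r, (p <= e r)%N -> u 0 r = 0.
Proof.
move=> [Ae A0]; rewrite mask_mul mask_eq0; split.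
  by move=> H r pr; rewrite -(normalized_coef u r Ae); apply: H.
move=> H q c pc; rewrite ord1 mxE big1 // => r _.
case: (leqP p (e r)) => [/H ->|ep]; first by rewrite mul0r.
by rewrite A0 ?mulr0 // (leq_trans ep).
Qed.

Lemma echelon_rank_mask e A B p : echelon e A -> echelon e B ->
  \rank (mask (from p) A) = \rank (mask (from p) B).
Proof.
move=> eA eB; apply: mxrank_eq_ker => u.
by rewrite (echelon_ker _ _ eA) (echelon_ker _ _ eB).
Qed.

Section Converse.
Variables (e : 'I_k -> 'I_n) (A B : 'M[C]_(k, n)).
Hypotheses (eB : echelon e B) (rA : \rank A = k).
Hypothesis AB : forall p, \rank (mask (from p) A) = \rank (mask (from p) B).

(** At a position p which is not a pivot the rank of the columns from p on
    equals the rank of the columns after p, so their left kernels coincide: u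
    kills column p if it kills all later ones. *)
Lemma leading_position (u : 'rV_k) (p : 'I_n) :
  (forall c : 'I_n, (p < c)%N -> (u *m A) 0 c = 0) ->
  (forall r, e r != p) -> (u *m A) 0 p = 0.
Proof.
move=> u0 ep.
have ker_le : (kermx (mask (from p) A) <= kermx (mask (from p.+1) A))%MS.
  apply/rV_subP => v /sub_kermxP; rewrite mask_mul => /mask_eq0 H.
  apply/sub_kermxP; rewrite mask_mul; apply/mask_eq0 => q c pc.
  by apply: H; apply: ltnW.
have : \rank (kermx (mask (from p) A)) = \rank (kermx (mask (from p.+1) A)).
  rewrite !mxrank_ker !AB; congr (_ - _)%N; apply: mxrank_eq_ker => v.
  rewrite !(echelon_ker _ _ eB); split => H r pr; apply: H; first exact: ltnW.
  by have := ep r; rewrite -val_eqE /=; lia.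
move=> /eqP; rewrite (mxrank_leqif_sup ker_le) => /rV_subP/(_ u) H.
have /H/sub_kermxP : (u <= kermx (mask (from p.+1) A))%MS.
  apply/sub_kermxP; rewrite mask_mul; apply/mask_eq0 => q c pc.
  by rewrite ord1; apply: u0.
by rewrite mask_mul => /mask_eq0; apply.
Qed.

Lemma pivots_unit : colsub e A \in unitmx.
Proof.
rewrite -row_free_unit -kermx_eq0; apply/eqP/row_matrixP => i; rewrite row0.
set u := row i _.
(* A combination of rows that vanishes at all pivots has no leading position. *)
have uA s : (u *m A) 0 (e s) = 0.
  have : u *m colsub e A = 0.
    by apply/sub_kermxP; rewrite row_sub.
  by rewrite mulmx_colsub => /rowP/(_ s); rewrite !mxE.
suff : u *m A = 0.
  by rewrite -(mul0mx 1 A); apply: row_free_inj; rewrite /row_free rA.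
apply/rowP => c; rewrite [RHS]mxE.
have [m] := ubnP (n - c); elim: m c => // m IH c cm.
have [[s es]|/forallNP nes] := pselect (exists s, e s = c); first by rewrite -es.
apply: leading_position; last by move=> r; apply/eqP.
by move=> d cd; apply: IH; have := ltn_ord d; lia.
Qed.

Lemma echelon_of_normalized : colsub e A = 1%:M -> echelon e A.
Proof.
move=> Ae; split => // r c; have [m] := ubnP (n - c).
elim: m c => // m IH c cm rc.
have [[s es]|/forallNP nes] := pselect (exists s, e s = c).
  rewrite -es (normalizedE _ _ Ae); case: eqP => // rs.
  by rewrite rs es ltnn in rc.
have := @leading_position (row r 1%:M) c; rewrite -row_mul mul1mx mxE.
apply; last by move=> s; apply/eqP.
move=> d cd; rewrite mxE; apply: IH; first by have := ltn_ord d; lia.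
exact: ltn_trans cd.
Qed.

End Converse.
End Echelon.

(** * Normalized representatives of points of the Grassmannian *)

Section Representatives.
Variables (C : fieldType) (k n : nat).

Definition normal_rep (e : 'I_k -> 'I_n) (P : set 'M[C]_(k, n)) : 'M[C]_(k, n) :=
  xget 0 [set M | P M /\ colsub e M = 1%:M].

Lemma GL_orbit_refl (A : 'M[C]_(k, n)) : GL_orbit A A.
Proof. by exists 1%:M; rewrite ?unitmx1 ?mul1mx. Qed.

Lemma normal_rep_orbit e (A : 'M[C]_(k, n)) : colsub e A \in unitmx ->
  normal_rep e (GL_orbit A) = invmx (colsub e A) *m A.
Proof.
move=> uA; rewrite /normal_rep; case: xgetP => [M _ [[g ug ->]]|].
  rewrite -mulmx_colsub => gA; congr (_ *m _).
  by rewrite -[RHS]mul1mx -gA mulmxK.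
move=> /(_ (invmx (colsub e A) *m A)) [].
split; first by exists (invmx (colsub e A)); rewrite ?unitmx_inv.
by rewrite -mulmx_colsub mulVmx.
Qed.

Lemma normal_rep_normalized e (A : 'M[C]_(k, n)) : colsub e A = 1%:M ->
  normal_rep e (GL_orbit A) = A.
Proof.
move=> Ae; rewrite normal_rep_orbit Ae ?unitmx1 //.
by rewrite invmx1 mul1mx.
Qed.

(** A lattice between C[[t^-1]] and t^n C[[t^-1]] determines the row space
    of the matrix, and matrices of full rank with equal row spaces differ by an
    element of GL_k. *)
Lemma lattice_point_lattice_of (A : 'M[C]_(k, n)) : \rank A = k ->
  @lattice_point C k n (lattice_of A) = GL_orbit A.
Proof.
move=> rA; apply/seteqP; split => [B [rB AB]|_ [g ug ->]]; last first.
  have E : (g *m A :=: A)%MS by apply: eqmxMfull; rewrite row_full_unit.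
  by split; [rewrite E|rewrite -(eqmx_lattice_of E)].
have BA : (B <= A)%MS.
  apply/row_subP => r.
  have : lattice_of B (poly_of (row r B)) by apply: poly_of_lattice; apply: row_sub.
  by rewrite [lattice_of B](esym AB) => -[_]; rewrite positive_partK.
have /submxP[g gA] := BA; exists g => //.
rewrite -row_free_unit /row_free eqn_leq rank_leq_row -{1}rB gA.
exact: mxrankM_maxl.
Qed.

End Representatives.

(** * Periodic column indices *)

Section Residues.
Variables (n : nat) (n_gt0 : (0 < n)%N).

Lemma residue_proof (a : int) : (absz (a %% n%:Z)%Z < n)%N.
Proof.
have n0 : n%:Z != 0 by lia.
by have := modz_ge0 a n0; have := ltz_pmod a (d := n%:Z); lia.
Qed.

Definition residue (a : int) : 'I_n := Ordinal (residue_proof a).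

Lemma residueE (a : int) : exists e : int, a = (residue a)%:Z + e * n%:Z.
Proof.
exists (a %/ n%:Z)%Z; rewrite /= {1}[a](divz_eq a n%:Z).
have n0 : n%:Z != 0 by lia.
by have := modz_ge0 a n0; lia.
Qed.

Lemma residue_eq (a e : int) (c : 'I_n) : a = c%:Z + e * n%:Z -> residue a = c.
Proof.
move=> ->; apply: ord_inj; rewrite /= addrC modzMDl modz_small //.
by have := ltn_ord c; lia.
Qed.

Lemma residueD (a e : int) : residue (a + e * n%:Z) = residue a.
Proof. by have [d Ha] := residueE a; apply: (@residue_eq _ (d + e)); lia. Qed.

Lemma residue_addn (a : int) : residue (a + n%:Z) = residue a.
Proof. by rewrite -(residueD a 1) mul1r. Qed.

Lemma residue_inj (a b : int) : residue a = residue b -> exists e : int, a = b + e * n%:Z.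
Proof.
move=> ab; have [d Ha] := residueE a; have [d' Hb] := residueE b.
by exists (d - d'); rewrite Ha ab [in RHS]Hb; lia.
Qed.

Lemma eqmod_residue (a : int) (c : 'I_n) :
  (a == c.+1%:Z %[mod n%:Z])%Z = (residue (a - 1) == c).
Proof.
rewrite eqz_mod_dvd; apply/dvdzP/eqP => [[e He]|ac].
  by apply: (@residue_eq _ e); lia.
have [e He] := residueE (a - 1); exists e.
by rewrite -ac; lia.
Qed.

(** Columns are numbered from 0, so position c of the window that starts at
    the column with index i (counted from 1) is the column i + c - 1 modulo n;
    [pos_of i] is the inverse map. *)
Definition col_at (i : int) (c : 'I_n) : 'I_n := residue (i + c%:Z - 1).
Definition pos_of (i : int) (c : 'I_n) : 'I_n := residue (c%:Z + 1 - i).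

Lemma col_atK i : cancel (pos_of i) (col_at i).
Proof.
move=> c; rewrite /col_at /pos_of; have [e He] := residueE (c%:Z + 1 - i).
by apply: (@residue_eq _ (- e)); lia.
Qed.

Lemma pos_ofK i : cancel (col_at i) (pos_of i).
Proof.
move=> c; rewrite /col_at /pos_of; have [e He] := residueE (i + c%:Z - 1).
by apply: (@residue_eq _ (- e)); lia.
Qed.

Lemma pos_of_addn i c : pos_of (i + n%:Z) c = pos_of i c.
Proof.
rewrite /pos_of -[RHS](residueD _ (-1)); congr residue; lia.
Qed.

Lemma col_at_addn i c : col_at (i + n%:Z) c = col_at i c.
Proof. by rewrite /col_at -[RHS]residue_addn; congr residue; lia. Qed.

Lemma pos_of_succ i c : (pos_of (i + 1) c : nat) =
  (if pos_of i c == 0%N :> nat then n.-1 else (pos_of i c).-1)%N.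
Proof.
have [e] := residueE (c%:Z + 1 - i); rewrite -/(pos_of i c).
move: (pos_of i c) => p He; have lt := ltn_ord p.
case: ifP => [/eqP p0|p0].
  have ln : (n.-1 < n)%N by lia.
  by rewrite /pos_of (@residue_eq _ (e - 1) (Ordinal ln)) //=; lia.
have ln : (p.-1 < n)%N by lia.
by rewrite /pos_of (@residue_eq _ e (Ordinal ln)) //=; lia.
Qed.

Lemma col_at_succ i (c d : 'I_n) : d = c.+1 :> nat -> col_at (i + 1) c = col_at i d.
Proof. by move=> dc; rewrite /col_at; congr residue; rewrite dc; lia. Qed.

End Residues.

(** * Windows of a periodic matrix and the opposite cell *)

Section Windows.
Variables (C : fieldType) (n k : nat) (n_gt0 : (0 < n)%N) (lam : 'I_k -> 'I_n).
Hypothesis lam_inj : injective lam.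

Notation residue := (residue n_gt0).
Notation col_at := (col_at n_gt0).
Notation pos_of := (pos_of n_gt0).

Definition pivot (i : int) (r : 'I_k) : 'I_n := pos_of i (lam r).

Definition window (i : int) (M : 'M[C]_(k, n)) : 'M[C]_(k, n) :=
  \matrix_(r, c) (if (c <= pivot i r)%N then M r (col_at i c) else 0).

Definition flag_of (M : 'M[C]_(k, n)) (i : int) : set (formal C) :=
  lattice_of (window i M).

Lemma pivot_addn i : pivot (i + n%:Z) = pivot i.
Proof. by apply/funext => r; apply: pos_of_addn. Qed.

Lemma window_addn i M : window (i + n%:Z) M = window i M.
Proof.
apply/matrixP => r c; rewrite !mxE pivot_addn; case: ifP => // _.
by rewrite col_at_addn.
Qed.

Lemma window_echelon i M : colsub lam M = 1%:M -> echelon (pivot i) (window i M).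
Proof.
move=> Mlam; split; last by move=> r c rc; rewrite mxE leqNgt rc.
apply/matrixP => r s; rewrite !mxE /pivot col_atK (normalizedE _ _ Mlam).
case: eqP => [->|_]; first by rewrite leqnn.
by rewrite if_same.
Qed.

Lemma window_rank i M : colsub lam M = 1%:M -> \rank (window i M) = k.
Proof. by case/(window_echelon i) => /rank_normalized. Qed.

Lemma AffGr_lattice_of (A : 'M[C]_(k, n)) : \rank A = k -> @AffGr C k n (lattice_of A).
Proof.
move=> rA; have sL := @series_sub_lattice_of C _ _ A.
have LI m : linear_subspace (lattice_of A `&` tpow_series m).
  by apply: linear_subspaceI; [apply: lattice_of_subspace|apply: tpow_series_subspace].
have H1 := quot_dim_series_pos A 0; rewrite maskT // rA in H1.
have H2 : quot_dim_eq (series (C := C)) (lattice_of A `&` series (C := C)) 0.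
  exists (fun=> 0); split; first by case.
  move=> x sx; exists 0; split; last by move=> c _; apply/rowP; case.
  by rewrite big_ord0 subr0; split => //; apply: sL.
split.
- split; [exact: lattice_of_subspace|exact: lattice_of_laurent|by exists k|by exists 0%N].
- move=> _ [x [xn _] <-]; apply: sL => j j0; rewrite /tshift; apply: xn; lia.
- by rewrite /lattice_index (quot_dimE (LI 0) H1) (quot_dimE (LI 0) H2) subr0.
Qed.

(** B contains the rows of A, translated by one position, except those whose
    pivot is in position 0 of A, which translate to 0. *)
Lemma window_shift i (A B : 'M[C]_(k, n)) :
  (forall r (c d : 'I_n), d = c.+1 :> nat ->
    A r d = if (pivot i r == 0 :> nat)%N then 0 else B r c) ->
  (forall r (c : 'I_n), c = n.-1 :> nat -> (0 < pivot i r)%N -> B r c = 0) ->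
  tshift (- 1) @` lattice_of A `<=` lattice_of B.
Proof.
move=> AB B0 _ [x [xn /submxP[u xA]] <-]; split.
  by move=> j nj; rewrite /tshift; apply: xn; lia.
apply/submxP; exists (\row_r (if (pivot i r == 0 :> nat)%N then 0 else u 0 r)).
apply/rowP => c; rewrite [LHS]mxE [RHS]mxE /tshift.
case: (ltnP c.+1 n) => cn.
  have -> : x (c.+1%:Z - -1) = positive_part n x 0 (Ordinal cn).
    by rewrite mxE; congr x => /=; lia.
  rewrite xA mxE; apply: eq_bigr => r _; rewrite mxE (AB r c) //.
  by case: ifP; rewrite ?mul0r ?mulr0.
rewrite xn; last by lia.
rewrite big1 // => r _; rewrite mxE; case: ifP => [|p0]; first by rewrite mul0r.
rewrite B0 ?mulr0 //; [by have := ltn_ord c; lia|by rewrite lt0n p0].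
Qed.

Lemma flag_of_AffFlag M : colsub lam M = 1%:M -> @AffFlag C k n (flag_of M).
Proof.
move=> Mlam; split.
- by move=> i; apply: AffGr_lattice_of; apply: window_rank.
- by move=> i; rewrite /flag_of window_addn.
move=> i; apply: (@window_shift i) => r c.
  move=> d dc; rewrite !mxE (col_at_succ _ _ dc) /pivot pos_of_succ dc.
  case: (posnP (pos_of i (lam r))) => [->|p0] //.
  by rewrite -[in LHS](prednK p0) ltnS.
move=> cn p0; rewrite mxE /pivot pos_of_succ; rewrite /pivot in p0.
by rewrite gtn_eqF // cn leqNgt; case: ltnP => //; have := ltn_ord (pos_of i (lam r)); lia.
Qed.

(** The torus-fixed point of the big cell, which the construction sends to
    the flag t_lambda. *)
Definition base_mx : 'M[C]_(k, n) := select_mx C lam.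

Lemma base_mx_normalized : colsub lam base_mx = 1%:M.
Proof. by apply/matrixP => r s; rewrite !mxE (inj_eq lam_inj) eq_sym. Qed.

Lemma coord_flag_t_pattern i :
  @coord_flag C (@t_pattern k n lam) i = flag_of base_mx i.
Proof.
have tE a : t_pattern lam a =
    if [exists r, residue (a - 1) == lam r] then a + n%:Z else a.
  by rewrite /t_pattern; under eq_existsb do rewrite eqmod_residue.
rewrite (@coord_flagE C n _ i [set pivot i r | r : 'I_k]%SET).
- rewrite /flag_of -(eqmx_lattice_of (eqmx_select_coord C (pivot i))).
  congr lattice_of; apply/matrixP => r c; rewrite !mxE.
  have -> : (col_at i c == lam r) = (c == pivot i r).
    by rewrite -[in RHS](pos_ofK n_gt0 i c) /pivot (inj_eq (can_inj (col_atK n_gt0 i))).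
  by case: eqP => [->|]; rewrite ?leqnn ?if_same.
- move=> j j0; case: (boolP [exists r, residue (i + j - 1 - 1) == lam r]) => H.
    exists (i + j - 1 - n%:Z); last by lia.
    rewrite tE ifT ?subrK //; case/existsP: H => r /eqP Hr; apply/existsP; exists r.
    rewrite -Hr; apply/eqP; rewrite -[LHS]residue_addn; congr residue; lia.
  by exists (i + j - 1); [rewrite tE (negbTE H)|lia].
- by move=> a ai; rewrite tE; case: ifP; lia.
- move=> c; split.
    move=> /imsetP[r _ cr]; exists (i + c%:Z - n%:Z); last by have := ltn_ord c; lia.
    rewrite tE ifT ?subrK //; apply/existsP; exists r; apply/eqP.
    rewrite -[RHS](col_atK n_gt0 i) -/(pivot i r) -cr /col_at -residue_addn.
    by congr residue; lia.
  move=> [a]; rewrite tE; case: ifP => [/existsP[r /eqP ar] E ai|_]; last by lia.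
  apply/imsetP; exists r => //; rewrite /pivot -ar.
  rewrite -[LHS](pos_ofK n_gt0 i); congr pos_of; rewrite /col_at -[RHS]residue_addn.
  by congr residue; lia.
Qed.


Lemma quot_dim_lattice_of_pos q d (A : 'M[C]_(d, q)) (m : nat) :
  quot_dim (lattice_of A) (lattice_of A `&` tpow_series m%:Z) =
  \rank (mask (fun c : 'I_q => (m <= c)%N) A).
Proof.
apply: quot_dimE; last exact: quot_dim_series_pos.
by apply: linear_subspaceI; [apply: lattice_of_subspace|apply: tpow_series_subspace].
Qed.

(** Windows of M and of [base_mx] are echelon forms with the same pivots,
    hence have the same leading exponents. *)
Lemma flag_of_opposite_cell M : colsub lam M = 1%:M -> opposite_cell lam (flag_of M).
Proof.
move=> Mlam; split; first exact: flag_of_AffFlag.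
move=> i m /=; rewrite coord_flag_t_pattern.
have M0 := base_mx_normalized.
case: m => p.
  rewrite !quot_dim_lattice_of_pos.
  by apply: (echelon_rank_mask p (window_echelon i Mlam) (window_echelon i M0)).
have -> : Negz p = - p.+1%:Z by [].
have LI (A : 'M[C]_(k, n)) m : linear_subspace (lattice_of A `&` tpow_series m).
  by apply: linear_subspaceI; [apply: lattice_of_subspace|apply: tpow_series_subspace].
rewrite (quot_dimE (LI _ _) (quot_dim_series_neg _ _)).
rewrite (quot_dimE (LI _ _) (quot_dim_series_neg _ _)).
by rewrite !window_rank.
Qed.

Section Reconstruction.
Variable L : int -> set (formal C).
Hypothesis HL : opposite_cell lam L.

Definition reduced_mx i : 'M[C]_(k, n) := normal_rep (pivot i) (@lattice_point C k n (L i)).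

Lemma opposite_cell_lattice i : exists A : 'M[C]_(k, n), [/\ \rank A = k,
  colsub (pivot i) A \in unitmx & L i = lattice_of A].
Proof.
have [[HG _ _] Hd] := HL; have [latL _ ind] := HG i.
have M0 := base_mx_normalized.
have dimL (m : nat) : quot_dim (L i) (L i `&` tpow_series m%:Z) =
    \rank (mask (fun c : 'I_n => (m <= c)%N) (window i base_mx)).
  by have := Hd i m%:Z; rewrite /= coord_flag_t_pattern quot_dim_lattice_of_pos.
have [||A [rA LA]] := @lattice_ofP C (L i) n k latL ind.
- by rewrite (dimL 0%N) maskT // window_rank.
- rewrite dimL (_ : mask _ _ = 0) ?mxrank0 //; apply/mask_eq0 => r c.
  by have := ltn_ord c; lia.
exists A; split => //.
apply: (pivots_unit (window_echelon i M0) rA) => p.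
by rewrite -dimL LA quot_dim_lattice_of_pos.
Qed.

Lemma reduced_mxP i : L i = lattice_of (reduced_mx i) /\
  echelon (pivot i) (reduced_mx i).
Proof.
have [A [rA uA LA]] := opposite_cell_lattice i.
have RA : reduced_mx i = invmx (colsub (pivot i) A) *m A.
  by rewrite /reduced_mx LA lattice_point_lattice_of // normal_rep_orbit.
have M0 := base_mx_normalized.
have EA : (reduced_mx i :=: A)%MS.
  by rewrite RA; apply: eqmxMfull; rewrite row_full_unit unitmx_inv.
have LR : L i = lattice_of (reduced_mx i) by rewrite LA (eqmx_lattice_of EA).
split => //.
apply: (echelon_of_normalized (window_echelon i M0)).
- by rewrite EA.
- move=> p; have [_ /(_ i p%:Z) /=] := HL.
  by rewrite coord_flag_t_pattern LR !quot_dim_lattice_of_pos.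
- by rewrite RA -mulmx_colsub mulVmx.
Qed.

Lemma reduced_mx_addn i : reduced_mx (i + n%:Z) = reduced_mx i.
Proof. by rewrite /reduced_mx pivot_addn; have [[_ <- _] _] := HL. Qed.

Lemma reduced_mx_addMn i e : reduced_mx (i + e * n%:Z) = reduced_mx i.
Proof.
elim/int_ind: e => [|m IH|m IH]; first by rewrite mul0r addr0.
  by rewrite -IH -[RHS]reduced_mx_addn; congr reduced_mx; lia.
by rewrite -IH -[LHS]reduced_mx_addn; congr reduced_mx; lia.
Qed.

(** The translate of row r lies in the row space of the next echelon form,
    and it has the entries of row r of that form in all its pivots: in the
    pivot that has just entered, in the last position, the translate vanishes. *)
Lemma reduced_mx_shift i r (c d : 'I_n) : d = c.+1 :> nat -> (0 < pivot i r)%N ->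
  reduced_mx i r d = reduced_mx (i + 1) r c.
Proof.
move=> dc r0; have [Li [Ai _]] := reduced_mxP i.
have [Li1 [Ai1 _]] := reduced_mxP (i + 1).
set A := reduced_mx i in Li Ai *; set B := reduced_mx (i + 1) in Li1 Ai1 *.
have [[_ _ HS] _] := HL.
have : L (i + 1) (tshift (- 1) (poly_of (row r A))).
  apply: HS; exists (poly_of (row r A)) => //.
  by rewrite Li; apply: poly_of_lattice; apply: row_sub.
rewrite Li1 => -[_]; set x := positive_part n _ => xB.
have xE (a b : 'I_n) : b = a.+1 :> nat -> x 0 a = A r b.
  move=> ba; rewrite mxE /tshift.
  have -> : a.+1%:Z - -1 = b.+1%:Z by rewrite ba; lia.
  by rewrite poly_of_nat mxE.
have xn (a : 'I_n) : a = n.-1 :> nat -> x 0 a = 0.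
  by move=> an; rewrite mxE /tshift poly_of_gt //; lia.
rewrite -(xE c d dc) (normalized_sub c Ai1 xB) (bigD1 r) //= big1.
  have lt := ltn_ord (pivot i r).
  rewrite (xE _ (pivot i r)); last first.
    by rewrite [in RHS]/pivot pos_of_succ -/(pivot i r) gtn_eqF //; lia.
  by rewrite (normalizedE _ _ Ai) eqxx mul1r addr0.
move=> s sr; case: (posnP (pivot i s)) => s0.
  by rewrite xn ?mul0r // [in LHS]/pivot pos_of_succ -/(pivot i s) s0.
rewrite (xE _ (pivot i s)); last first.
  by rewrite [in RHS]/pivot pos_of_succ -/(pivot i s) gtn_eqF //; lia.
by rewrite (normalizedE _ _ Ai) eq_sym (negbTE sr) mul0r.
Qed.

(** The index at which the pivot of row r occupies the last position, so that
    the window shows the whole row.  The column lam r, counted from 0, has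
    index lam r + 1, and the window following it starts with index
    lam r + 2. *)
Definition full_index r : int := (lam r)%:Z + 2.

Definition glued_mx : 'M[C]_(k, n) :=
  \matrix_(r, c) reduced_mx (full_index r) r (pos_of (full_index r) c).

Lemma pivot_full_index r : pivot (full_index r) r = n.-1 :> nat.
Proof.
have ln : (n.-1 < n)%N by lia.
by rewrite /pivot /pos_of (@residue_eq _ _ _ (-1) (Ordinal ln)) // /full_index /=; lia.
Qed.

Lemma glued_normalized : colsub lam glued_mx = 1%:M.
Proof.
apply/matrixP => r s; rewrite !mxE -/(pivot (full_index r) s).
by have [_ [A _]] := reduced_mxP (full_index r); rewrite (normalizedE _ _ A).
Qed.

(** Induction on the distance of the pivot of row r from the last
    position. *)
Lemma reduced_mx_window i : reduced_mx i = window i glued_mx.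
Proof.
apply/matrixP => r c; rewrite mxE; case: leqP => rc; last first.
  by have [_ [_ ->]] := reduced_mxP i.
rewrite mxE.
(* m is the distance of the pivot of row r from the last position. *)
suff H m j (d : 'I_n) : (pivot j r + m = n.-1)%N -> (d <= pivot j r)%N ->
    reduced_mx j r d = reduced_mx (full_index r) r (pos_of (full_index r) (col_at j d)).
  by apply: (H (n.-1 - pivot i r)%N) => //; have := ltn_ord (pivot i r); lia.
elim: m j d => [|m IH] j d pm dp.
  have : pivot j r = pivot (full_index r) r.
    by apply: ord_inj; rewrite pivot_full_index; lia.
  move=> /residue_inj[e je].
  have -> : j = full_index r + (- e) * n%:Z by lia.
  rewrite reduced_mx_addMn; congr (reduced_mx _ r _).
  rewrite -[LHS](pos_ofK n_gt0 (full_index r)); congr pos_of.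
  by rewrite /col_at -[RHS](residueD n_gt0 _ e); congr residue; lia.
have pj : (pivot (j - 1) r : nat) = (pivot j r).+1.
  have := pos_of_succ n_gt0 (j - 1) (lam r); rewrite subrK -/(pivot _ r) -/(pivot _ r).
  by case: eqP; lia.
have ln : (d.+1 < n)%N by have := ltn_ord (pivot j r); lia.
have := @reduced_mx_shift (j - 1) r d (Ordinal ln) erefl; rewrite subrK => <-; last by lia.
rewrite IH; [|by lia|by rewrite pj].
by rewrite -(@col_at_succ _ n_gt0 (j - 1) d) // subrK.
Qed.

Lemma flag_of_glued : flag_of glued_mx = L.
Proof.
apply/funext => i; rewrite /flag_of -reduced_mx_window.
by have [<-] := reduced_mxP i.
Qed.

End Reconstruction.

Lemma reduced_mx_flag_of M i : colsub lam M = 1%:M ->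
  reduced_mx (flag_of M) i = window i M.
Proof.
move=> Mlam; rewrite /reduced_mx lattice_point_lattice_of ?window_rank //.
by rewrite normal_rep_normalized //; case: (window_echelon i Mlam).
Qed.

Lemma glued_flag_of M : colsub lam M = 1%:M -> glued_mx (flag_of M) = M.
Proof.
move=> Mlam; apply/matrixP => r c; rewrite mxE reduced_mx_flag_of // mxE.
rewrite pivot_full_index ifT ?col_atK //.
by have := ltn_ord (pos_of (full_index r) c); lia.
Qed.

End Windows.

(** * Schubert conditions and rank conditions *)

Section IntervalRanks.
Variables (C : fieldType) (n k : nat) (n_gt0 : (0 < n)%N).

Lemma periodic_colE (M : 'M[C]_(k, n)) (a : int) :
  periodic_col M a = col (residue n_gt0 (a - 1)) M.
Proof.
rewrite /periodic_col; case: pickP => [c|/(_ (residue n_gt0 (a - 1)))].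
  by rewrite (eqmod_residue n_gt0) => /eqP ->.
by rewrite (eqmod_residue n_gt0) eqxx.
Qed.

Lemma interval_rank_mul (h : 'M[C]_k) (M : 'M[C]_(k, n)) i j : h \in unitmx ->
  interval_rank (h *m M) i j = interval_rank M i j.
Proof.
move=> uh; rewrite /interval_rank.
set A := (X in _ = \rank X); rewrite (_ : (\matrix_(_, _) _) = h *m A).
  by rewrite (eqmxMfull A) // row_full_unit.
apply/matrixP => r s; rewrite !mxE periodic_colE !mxE; apply: eq_bigr => t _.
by rewrite !mxE periodic_colE !mxE.
Qed.

(** A row vector in the left kernel of either matrix vanishes at all rows
    whose pivot is in the interval, because those pivot columns are unit
    columns; on the remaining rows the matrices agree. *)
Lemma interval_rank_window (lam : 'I_k -> 'I_n) (M : 'M[C]_(k, n)) (i j : int) :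
  colsub lam M = 1%:M -> i <= j < i + n%:Z ->
  interval_rank M i j =
  \rank (mask (fun c : 'I_n => (c < absz (j - i + 1)%R)%N) (window n_gt0 lam i M)).
Proof.
move=> Mlam ij; rewrite /interval_rank; set l := absz _.
have ln : (l <= n)%N by rewrite /l; lia.
have [We _] := window_echelon n_gt0 i Mlam.
apply: mxrank_eq_ker => u.
set A := \matrix_(_, _) _.
have AE (s : 'I_l) : (u *m A) 0 s =
    \sum_r u 0 r * M r (col_at n_gt0 i (widen_ord ln s)).
  rewrite mxE; apply: eq_bigr => r _; rewrite mxE periodic_colE mxE.
  by [].
have u0E (c : 'I_n) : (c < l)%N ->
    (forall r, (pivot n_gt0 lam i r < l)%N -> u 0 r = 0) ->
    (u *m window n_gt0 lam i M) 0 c = \sum_r u 0 r * M r (col_at n_gt0 i c).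
  move=> cl u0; rewrite mxE; apply: eq_bigr => r _; rewrite mxE.
  case: leqP => // rc; rewrite u0 ?mul0r //; exact: ltn_trans cl.
rewrite mask_mul mask_eq0; split.
  move=> uA; have uA' (c : 'I_n) : (c < l)%N ->
      \sum_r u 0 r * M r (col_at n_gt0 i c) = 0.
    move=> cl; have := AE (Ordinal cl); rewrite uA mxE => E; rewrite [RHS]E.
    by apply: eq_bigr => r _; congr (_ * M _ (col_at _ _ _)); apply: ord_inj.
  move=> q c cl; rewrite ord1 u0E ?uA' // => r rl.
  have := uA' _ rl; rewrite /pivot col_atK (bigD1 r) //= big1.
    by rewrite (normalizedE _ _ Mlam) eqxx mulr1 addr0.
  by move=> s sr; rewrite (normalizedE _ _ Mlam) (negbTE sr) mulr0.
move=> uW; apply/rowP => s; have sl : (widen_ord ln s < l)%N by apply: (ltn_ord s).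
rewrite AE [RHS]mxE -(u0E _ sl); first exact: uW.
by move=> r rl; rewrite -(normalized_coef u r We); apply: uW.
Qed.

End IntervalRanks.

Section Schubert.
Variables (C : fieldType) (n k : nat) (n_gt0 : (0 < n)%N) (lam : 'I_k -> 'I_n).
Hypothesis lam_inj : injective lam.
Variables (f : int -> int).
Hypothesis jf : bounded_juggling n k f.

(** Both lattices contain C[[t^-1]] with quotient of the same dimension, so
    the conditions for m <= 0 hold trivially, and so do those beyond t^n. *)
Lemma subspace_dim_lattice_of_coord d (A : 'M[C]_(d, n)) (J : {set 'I_n}) :
  \rank A = #|J| ->
  (forall m : int, (subspace_dim (lattice_of (coord_mx C J) `&` tpow_poly m) <=
     subspace_dim (lattice_of A `&` tpow_poly m))%N) <->
  (forall l : nat, (l <= n)%N ->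
     (\rank (mask (fun c : 'I_n => (c < l)%N) A) <= #|[set c in J | (c < l)%N]%SET|)%N).
Proof.
move=> rA.
have maskJ (l : nat) : \rank (mask (fun c : 'I_n => (c < l)%N) (coord_mx C J)) =
    #|[set c in J | (c < l)%N]%SET|.
  by rewrite mask_coord_mx rank_coord_mx.
have mask_le d' (B : 'M[C]_(d', n)) (l : nat) :
    (\rank (mask (fun c : 'I_n => (c < l)%N) B) <= \rank B)%N.
  set S := (fun c : 'I_n => _).
  have -> : mask S B = B *m mask S 1%:M by rewrite mask_mul mulmx1.
  exact: mxrankM_maxl.
split => [H l ln|H m].
  have := H l.+1%:Z; rewrite !subspace_dim_poly_pos maskJ rA rank_coord_mx.
  have := mask_le _ A l; rewrite rA; have := mask_le _ (coord_mx C J) l.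
  rewrite maskJ rank_coord_mx; lia.
case: (ltP 0 m) => m0; last first.
  have -> : m = 1 - (absz (1 - m)%R)%:Z by lia.
  by rewrite !subspace_dim_poly_neg rA rank_coord_mx.
have -> : m = (absz (m - 1)%R).+1%:Z by lia.
set l := absz _; rewrite !subspace_dim_poly_pos maskJ rA rank_coord_mx.
case: (leqP l n) => ln; first by apply: leq_sub2l; apply: H.
rewrite (_ : [set c in J | (c < l)%N]%SET = J) ?subnn //.
by apply/setP => c; rewrite inE andbC (ltn_trans _ ln).
Qed.

(** In terms of ranks of initial segments of windows both sides are the same
    family of inequalities; the positroid conditions for j = i + n hold
    automatically, as a rank is at most k. *)
Lemma schubert_positroid (M : 'M[C]_(k, n)) : colsub lam M = 1%:M ->
  affine_schubert k n f (flag_of n_gt0 lam M) <-> positroid f (GL_orbit M).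
Proof.
move=> Mlam; have [[[g fK gK] fn] _ fb] := jf.
pose J i := [set c : 'I_n | (g (i + c%:Z) < i)%R]%SET.
have cJ i : #|J i| = k := card_balls_in_air n_gt0 jf fK gK i.
have fE i : @coord_flag C f i = lattice_of (coord_mx C (J i)).
  apply: coord_flagE.
  - move=> j j0; exists (g (i + j - 1)); first by rewrite gK.
    by have := fb (g (i + j - 1)); rewrite gK; lia.
  - by move=> a ai; have := fb a; lia.
  - move=> c; rewrite inE; split => [gi|[a fa ai]].
      by exists (g (i + c%:Z)); rewrite ?gK.
    by rewrite -fa fK.
have rW i : \rank (window n_gt0 lam i M) = k by apply: window_rank.
have -> : affine_schubert k n f (flag_of n_gt0 lam M) <-> forall i l, (l <= n)%N ->
    (\rank (mask (fun c : 'I_n => (c < l)%N) (window n_gt0 lam i M)) <=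
     #|[set c in J i | (c < l)%N]%SET|)%N.
  split => [[_ H] i|H].
    apply/subspace_dim_lattice_of_coord; first by rewrite rW cJ.
    by move=> m; have := H i m; rewrite fE.
  split; first exact: flag_of_AffFlag.
  move=> i; rewrite fE; apply/subspace_dim_lattice_of_coord; first by rewrite rW cJ.
  exact: H.
have JE i (l : nat) : [set c in J i | (c < l)%N]%SET =
    [set c : 'I_n | (c < l)%N && (g (i + c%:Z) < i)%R]%SET.
  by apply/setP => c; rewrite !inE andbC.
split => [H|[N [MN _ HN]] i l ln].
  exists M; split => //; first exact: rank_normalized Mlam.
  move=> i j ij; rewrite (card_balls_below n_gt0 jf fK gK ij) lez_nat -JE.
  set l := absz _; case: (ltP j (i + n%:Z)) => jn.
    rewrite (interval_rank_window n_gt0 Mlam); last by lia.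
    by apply: H; rewrite /l; lia.
  rewrite (_ : [set c in J i | _]%SET = J i); first by rewrite cJ rank_leq_row.
  apply/setP => c; rewrite inE andbC; have -> // : (c < l)%N.
  by have := ltn_ord c; rewrite /l; lia.
case: l ln => [|l] ln.
  by rewrite (_ : mask _ _ = 0) ?mxrank0 //; apply/mask_eq0.
have [h uh NE] : GL_orbit M N by rewrite MN; apply: GL_orbit_refl.
have ij : i <= i + l%:Z <= i + n%:Z by lia.
have := HN _ _ ij; rewrite (card_balls_below n_gt0 jf fK gK ij) lez_nat -JE.
rewrite NE (interval_rank_mul n_gt0) // (interval_rank_window n_gt0 Mlam); last by lia.
have -> // : absz (i + l%:Z - i + 1)%R = l.+1 by lia.
Qed.

End Schubert.

(** * The isomorphism *)

Section RegularRepresentatives.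
Variables (C : fieldType) (k n : nat).

(** The representative normalized at e is defined on the image V of the open
    set where the columns e of N x are independent.  This set is saturated, so
    V is open in the quotient, and there the representative is
    colsub e (N x) ^ -1 N x.  Stated for general N and Q to cover both a
    Grassmannian and a factor of a product of Grassmannians. *)
Lemma reg_normal_rep S T T' (X : fun_space C S) (pi : S -> T')
    (N : S -> 'M[C]_(k, n)) (Q : T' -> set 'M[C]_(k, n)) (iota : T -> T')
    (A : set T) (e : 'I_k -> 'I_n) r c :
  space_axioms X ->
  (forall r c, fs_reg X (fs_points X) (fun x => N x r c)) ->
  (forall x, fs_points X x -> Q (pi x) = GL_orbit (N x)) ->
  (forall a, A a -> exists x, [/\ fs_points X x, pi x = iota a &
     colsub e (N x) \in unitmx]) ->
  fs_reg (induced_space (quotient_space X pi) iota A) A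
    (fun a => normal_rep e (Q (iota a)) r c).
Proof.
move=> HX rN QN HA; set Y := quotient_space X pi.
have rNe i j : fs_reg X (fs_points X) (fun x => colsub e (N x) i j).
  apply: (reg_ext HX (open_points HX) (h := fun x => N x i (e j))) => // x _.
  by rewrite mxE.
have oX := open_det_neq0 HX (A := fun x => colsub e (N x)) rNe.
set U := _ `&` _ in oX.
have UE : fs_points X `&` pi @^-1` (pi @` U) = U.
  apply/seteqP; split => x; last by move=> Ux; split; [case: Ux|exists x].
  move=> [Xx [y [Xy uy] yx]]; split => //=.
  have [h uh ->] : GL_orbit (N y) (N x).
    by rewrite -(QN y) // yx QN //; apply: GL_orbit_refl.
  by rewrite -mulmx_colsub unitmx_mul uh.
apply: (@induced_reg _ _ _ Y iota A (pi @` U) (fun y => normal_rep e (Q y) r c)).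
- by split; [move=> _ [x [Xx _] <-]; exists x|rewrite UE].
- by move=> a /HA[x [Xx <- ux]]; exists x.
rewrite /= UE.
have UX : U `<=` fs_points X by move=> ? [].
apply: (reg_ext HX oX (h := fun x => \sum_s invmx (colsub e (N x)) r s * N x s c)).
  by move=> x [Xx ux] /=; rewrite QN // normal_rep_orbit // mxE.
apply: (reg_sum HX) => // s _; apply: (reg_mul HX) => //.
  apply: (reg_invmx HX oX) => [i j|x []//].
  exact: (reg_restrict HX _ (open_points HX)).
exact: (reg_restrict HX _ (open_points HX)).
Qed.

End RegularRepresentatives.

Section Isomorphism.
Variables (C : fieldType) (n k : nat) (n_gt0 : (0 < n)%N) (lam : 'I_k -> 'I_n).
Hypothesis lam_inj : injective lam.

Let mat_space := subspace
  (affine_space (fun (M : 'M[C]_(k, n)) (e : 'I_k * 'I_n) => M e.1 e.2))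
  [set M | \rank M = k].
Let mat_tuples := subspace
  (affine_space (fun (M : 'I_n -> 'M[C]_(k, n)) (e : 'I_n * 'I_k * 'I_n) =>
     M e.1.1 e.1.2 e.2))
  [set M | forall i, \rank (M i) = k].

Let mat_space_axioms : space_axioms mat_space.
Proof. by apply: induced_space_axioms => //; apply: affine_space_axioms. Qed.

Let mat_tuples_axioms : space_axioms mat_tuples.
Proof. by apply: induced_space_axioms => //; apply: affine_space_axioms. Qed.

Let Gr_axioms : space_axioms (Gr C k n).
Proof. exact: quotient_space_axioms. Qed.

Let Gr_power_axioms : space_axioms (Gr_power C n k n).
Proof. exact: quotient_space_axioms. Qed.

Let big_sub (P : set 'M[C]_(k, n)) : big_cell lam P -> fs_points (Gr C k n) P.
Proof.
by move=> [M [-> Mlam]]; exists M => //; apply: rank_normalized Mlam.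
Qed.

Let reduced L := reduced_mx (C := C) n_gt0 lam L.

Let reduced_rank L i : opposite_cell lam L -> \rank (reduced L i) = k.
Proof. by move=> HL; have [_ [/rank_normalized]] := reduced_mxP n_gt0 lam_inj HL i. Qed.

Let flag_pointE L (i : 'I_n) : opposite_cell lam L ->
  flag_point L i = GL_orbit (reduced L i.+1%:Z).
Proof.
move=> HL; rewrite -(lattice_point_lattice_of (reduced_rank i.+1%:Z HL)).
by rewrite /flag_point; have [<-] := reduced_mxP n_gt0 lam_inj HL i.+1%:Z.
Qed.

Let opposite_sub L : opposite_cell lam L ->
  fs_points (Gr_power C n k n) (@flag_point C k n L).
Proof.
move=> HL; exists (fun i : 'I_n => reduced L i.+1%:Z).
  by move=> i /=; apply: reduced_rank.
by apply/funext => i; rewrite flag_pointE.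
Qed.

Let big_axioms : space_axioms (big_cell_var C lam).
Proof. exact: induced_space_axioms. Qed.

Let opposite_axioms : space_axioms (opposite_cell_var C lam).
Proof. exact: induced_space_axioms. Qed.

Definition cell_to_flag (P : set 'M[C]_(k, n)) : int -> set (formal C) :=
  flag_of n_gt0 lam (normal_rep lam P).

Definition flag_to_cell (L : int -> set (formal C)) : set 'M[C]_(k, n) :=
  GL_orbit (glued_mx n_gt0 lam L).

Let normal_rep_big (P : set 'M[C]_(k, n)) : big_cell lam P ->
  P = GL_orbit (normal_rep lam P) /\ colsub lam (normal_rep lam P) = 1%:M.
Proof. by move=> [M [-> Mlam]]; rewrite normal_rep_normalized. Qed.

Lemma cell_to_flag_points (P : set 'M[C]_(k, n)) :
  big_cell lam P -> opposite_cell lam (cell_to_flag P).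
Proof. by move=> /normal_rep_big[_]; apply: flag_of_opposite_cell. Qed.

Lemma flag_to_cell_points (L : int -> set (formal C)) :
  opposite_cell lam L -> big_cell lam (flag_to_cell L).
Proof. by move=> HL; exists (glued_mx n_gt0 lam L); split => //; apply: glued_normalized. Qed.

Lemma cell_to_flagK (P : set 'M[C]_(k, n)) : big_cell lam P -> flag_to_cell (cell_to_flag P) = P.
Proof.
move=> /normal_rep_big[PE Plam].
by rewrite /flag_to_cell /cell_to_flag glued_flag_of // -PE.
Qed.

Lemma flag_to_cellK (L : int -> set (formal C)) :
  opposite_cell lam L -> cell_to_flag (flag_to_cell L) = L.
Proof.
move=> HL; rewrite /cell_to_flag /flag_to_cell normal_rep_normalized.
  exact: flag_of_glued.
exact: glued_normalized.
Qed.

Let reg_entry r c : fs_reg mat_space (fs_points mat_space) (fun M => M r c).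
Proof.
apply: (morphism_reg (affine_space_axioms _) (induced_morphism _) (coord_reg _ (r, c))).
by [].
Qed.

Let reg_tuple_entry i r c :
  fs_reg mat_tuples (fs_points mat_tuples) (fun M => M i r c).
Proof.
apply: (morphism_reg (affine_space_axioms _) (induced_morphism _) (coord_reg _ (i, r, c))).
by [].
Qed.

(** The map lifts to tuples of matrices: the entries of windows are entries
    of the normalized representative, or 0. *)
Lemma cell_to_flag_morphism :
  is_morphism (big_cell_var C lam) (opposite_cell_var C lam) cell_to_flag.
Proof.
apply: morphism_to_induced => //; first exact: cell_to_flag_points.
pose tup (P : set 'M[C]_(k, n)) (i : 'I_n) := window n_gt0 lam i.+1%:Z (normal_rep lam P).
apply: (morphism_ext (phi := (fun M i => GL_orbit (M i)) \o tup)) => //.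
  move=> P HP; apply/funext => i /=; rewrite flag_pointE; last exact: cell_to_flag_points.
  by rewrite /reduced reduced_mx_flag_of //; case: (normal_rep_big HP).
apply: (morphism_comp (Y := mat_tuples)); last exact: quotient_morphism.
apply: morphism_to_induced => //.
  by move=> P /normal_rep_big[_ Plam] i; apply: window_rank.
apply: morphism_affine => // -[[i r] c] /=.
have oB := open_points big_axioms.
apply: (reg_ext big_axioms oB (h := fun P => if (c <= pivot n_gt0 lam i.+1%:Z r)%N
   then normal_rep lam P r (col_at n_gt0 i.+1%:Z c) else 0)).
  by move=> P _; rewrite mxE.
case: (c <= pivot n_gt0 lam i.+1%:Z r)%N; last exact: (reg_cst big_axioms).
apply: (reg_normal_rep (Q := id) (N := id) (iota := id)) => //.
move=> P /normal_rep_big[PE Plam]; exists (normal_rep lam P); split => //.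
  exact: rank_normalized Plam.
by rewrite Plam unitmx1.
Qed.

(** The map lifts to matrices: row r is a row of the echelon form of L_i, for
    i the representative in 1, ..., n of [full_index r]. *)
Lemma flag_to_cell_morphism :
  is_morphism (opposite_cell_var C lam) (big_cell_var C lam) flag_to_cell.
Proof.
apply: morphism_to_induced => //; first exact: flag_to_cell_points.
apply: (morphism_comp (phi := glued_mx n_gt0 lam) (Y := mat_space)); last exact: quotient_morphism.
apply: morphism_to_induced => //.
  by move=> L HL; apply: rank_normalized (glued_normalized n_gt0 lam_inj HL).
apply: morphism_affine => // -[r c] /=.
have oO := open_points opposite_axioms.
pose i := residue n_gt0 (full_index lam r - 1).
have [d Hd] := residueE n_gt0 (full_index lam r - 1).
have iE : full_index lam r = i.+1%:Z + d * n%:Z by rewrite /i; lia.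
apply: (reg_ext opposite_axioms oO (h := fun L => normal_rep
   (pivot n_gt0 lam i.+1%:Z) (flag_point L i) r (pos_of n_gt0 (full_index lam r) c))).
  by move=> L HL; rewrite mxE {1}iE reduced_mx_addMn.
apply: (reg_normal_rep (X := mat_tuples) (Q := fun Q => Q i) (N := fun M => M i)) => //.
move=> L HL; exists (fun j : 'I_n => reduced L j.+1%:Z); split.
- by move=> j /=; apply: reduced_rank.
- by apply/funext => j; rewrite flag_pointE.
have [_ [-> _]] := reduced_mxP n_gt0 lam_inj HL i.+1%:Z.
exact: unitmx1.
Qed.

Lemma cell_to_flag_isomorphism :
  is_isomorphism (big_cell_var C lam) (opposite_cell_var C lam) cell_to_flag.
Proof.
split; first exact: cell_to_flag_morphism.
exists flag_to_cell; split; [exact: flag_to_cell_morphism|exact: cell_to_flagK|exact: flag_to_cellK].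
Qed.

Section Stratum.
Variable f : int -> int.
Hypothesis jf : bounded_juggling n k f.

Lemma cell_to_flag_stratum (P : set 'M[C]_(k, n)) : big_cell lam P ->
  affine_schubert k n f (cell_to_flag P) <-> positroid f P.
Proof.
move=> /normal_rep_big[PE Plam].
by rewrite [in X in _ <-> X]PE; apply: schubert_positroid.
Qed.

Lemma flag_to_cell_stratum (L : int -> set (formal C)) : opposite_cell lam L ->
  affine_schubert k n f L -> positroid f (flag_to_cell L).
Proof.
move=> HL SL; apply/cell_to_flag_stratum; first exact: flag_to_cell_points.
by rewrite flag_to_cellK.
Qed.

Lemma cell_to_flag_stratum_isomorphism :
  is_isomorphism (positroid_cell_var C f lam) (affine_KL_var C f lam) cell_to_flag.
Proof.
have pts P : (positroid f `&` big_cell lam) P ->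
    (affine_schubert k n f `&` opposite_cell lam) (cell_to_flag P).
  by move=> [Pf PB]; split; [apply/cell_to_flag_stratum|apply: cell_to_flag_points].
have pts' L : (affine_schubert k n f `&` opposite_cell lam) L ->
    (positroid f `&` big_cell lam) (flag_to_cell L).
  by move=> [Lf LO]; split; [apply: flag_to_cell_stratum|apply: flag_to_cell_points].
split.
  apply: (morphism_restrict _ _ _ _ _ _ cell_to_flag_morphism) => //;
    exact: subIsetr.
exists flag_to_cell; split.
- apply: (morphism_restrict _ _ _ _ _ _ flag_to_cell_morphism) => //;
    exact: subIsetr.
- by move=> P [_ PB]; apply: cell_to_flagK.
- by move=> L [_ LO]; apply: flag_to_cellK.
Qed.

Lemma cell_to_flag_image :
  cell_to_flag @` fs_points (positroid_cell_var C f lam) =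
  fs_points (affine_KL_var C f lam).
Proof.
apply/seteqP; split => [_ [P [Pf PB] <-]|L [Lf LO]].
  by split; [apply/cell_to_flag_stratum|apply: cell_to_flag_points].
exists (flag_to_cell L); last exact: flag_to_cellK.
by split; [apply: flag_to_cell_stratum|apply: flag_to_cell_points].
Qed.

End Stratum.
End Isomorphism.

Theorem theorem15 (R : realType) (n k : nat) (lam : 'I_k -> 'I_n)
    (n_gt0 : (0 < n)%N)
    (lam_incr : forall r s : 'I_k, (r < s)%N -> (lam r < lam s)%N) :
  (forall f : int -> int, bounded_juggling n k f ->
     isomorphic (positroid_cell_var R[i] f lam) (affine_KL_var R[i] f lam)) /\
  (exists phi : set 'M[R[i]]_(k, n) -> (int -> set (formal R[i])),
     is_isomorphism (big_cell_var R[i] lam) (opposite_cell_var R[i] lam) phi /\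
     forall f : int -> int, bounded_juggling n k f ->
       phi @` fs_points (positroid_cell_var R[i] f lam) =
       fs_points (affine_KL_var R[i] f lam)).
Proof.
have lam_inj : injective lam.
  move=> r s /(congr1 val) /= rs; apply: ord_inj.
  by case: (ltngtP r s) => // /lam_incr; rewrite rs ltnn.
split => [f jf|].
  exists (cell_to_flag n_gt0 lam).
  exact: cell_to_flag_stratum_isomorphism.
exists (cell_to_flag n_gt0 lam); split; first exact: cell_to_flag_isomorphism.
by move=> f jf; apply: cell_to_flag_image.
Qed.
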